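(* Let $\beta>0$ and consider the sequence of inventory systems indexed by the demand rate $r\to\infty$, with exponentially distributed lead times of mean $1/\beta$, operating under the GBS policy with parameters $\gamma=\gamma(r)$, $f=f(r)$, $x_*=x_*(r)$, where $f(r)>0$, $f(r)/r\to0$, $f(r)/\sqrt r\to\infty$, $x_*(r)\in\mathbb R$ depends on $r$ arbitrarily, and $\gamma(r)\ge 1$ is an integer that may depend on $r$. Then the dependence $\gamma=\gamma(r)$ can be chosen in such a way that (the process $(Y^r(t),Z^r(t))$ is positive recurrent for all sufficiently large $r$ and), as $r\to\infty$, $$\frac{Y^r(\infty)-x_*(r)}{\sqrt r}\Rightarrow 0\qquad\text{and, moreover,}\qquad \mathbb E\,\frac{|Y^r(\infty)-x_*(r)|}{\sqrt r}\to 0 .$$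
   Context: Notation: $a\vee b=\max\{a,b\}$, $a\wedge b=\min\{a,b\}$; $\lceil a\rceil$ is the smallest integer $\ge a$; $\Rightarrow$ is convergence in distribution. The parameter $r$ runs along an increasing sequence of positive reals tending to infinity. Model. Demand units (customers) arrive as a Poisson process of rate $r$. Each ordered supply unit (item) arrives after a lead time; lead times are i.i.d. (and independent of demand), here exponential with mean $1/\beta$. $Y^r(t)\in\mathbb Z$ is the net inventory level (inventory on hand minus backlog) and $Z^r(t)\in\mathbb Z_+$ is the number of in-transit items (ordered, not yet arrived). GBS policy with parameters $\gamma>0$, $f>0$, $x_*\in\mathbb R$. Let $X_*^r=r/\beta$, and for a net inventory level $y$ let $X^r=X_*^r-\gamma(y-x_* )$ (target) and $T^r(y)=[X^r\wedge(X_*^r+f)]\vee 0$ (truncated target). The policy acts only at customer and item arrival times. At such a time: (1) a customer arrival changes $Y:=Y-1$; an item arrival changes $Y:=Y+1$, $Z:=Z-1$; (2) $T$ is recomputed from the new $Y$; (3) $A=\lceil T-Z\rceil\vee 0$ new items are ordered, $Z:=Z+A$. Thus with exponential lead times $(Y^r(t),Z^r(t))$ is a continuous-time Markov chain with transitions $$(y,z)\to\bigl(y-1,\ z\vee\lceil T^r(y-1)\rceil\bigr)\ \text{at rate } r,\qquad (y,z)\to\bigl(y+1,\ (z-1)\vee\lceil T^r(y+1)\rceil\bigr)\ \text{at rate }\beta z .$$ The state space is the set of states reachable from the states $(y,\lceil X_*^r+f\rceil)$ with $y$ sufficiently negative (states outside this set are transient). $(Y^r(\infty),Z^r(\infty))$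 denotes the random state of the process in its stationary regime. *)

(* Defs.v *)
From HB Require Import structures.
From mathcomp Require Import all_boot all_order all_algebra.
From mathcomp Require Import all_classical all_reals all_analysis.
Import Order.TTheory GRing.Theory Num.Theory.
Import numFieldNormedType.Exports.

Set Implicit Arguments.
Unset Strict Implicit.
Unset Printing Implicit Defensive.

Local Open Scope classical_set_scope.
Local Open Scope ring_scope.

(* A continuous-time Markov chain is given by the finite list of its
   transitions: [(a, s')] in [trans s] means "s -> s' at rate a".  In the
   definitions below the total exit rates are positive and no transition leads
   from a state to itself. *)
Section ctmc.
Context {R : realType} {S : choiceType}.
Variable trans : S -> seq (R * S).

Definition step : rel S :=
  fun s s' => has (fun a => (0 < a.1) && (a.2 == s')) (trans s).

Definition reachable (s s' : S) : Prop :=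
  exists p : seq S, path step s p /\ last s p = s'.

Definition exit_rate (s : S) : R := \sum_(a <- trans s) a.1.

Definition generator (g : S -> R) (s : S) : R :=
  \sum_(a <- trans s) a.1 * (g a.2 - g s).

(* P_s(X(t) \in A), the transition semigroup being exp (t * generator).  This
   is meant for chains with bounded rates on their state space. *)
Definition transition_prob (t : R) (s : S) (A : set S) : R :=
  limn (fun n =>
    \sum_(0 <= k < n) t ^+ k / k`!%:R * iter k generator (\1_A) s).

(* [return_prob i n s] is the probability that the chain started in [s] is in
   [i] right after one of its first [n] jumps. *)
Fixpoint return_prob (i : S) (n : nat) (s : S) : R :=
  if n is n'.+1 then
    \sum_(a <- trans s)
      a.1 / exit_rate s * (if a.2 == i then 1 else return_prob i n' a.2)
  else 0.

(* [mean_return_time i n s] is E_s[min(T_i, J_n)], where J_n is the time of the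
   n-th jump and T_i the first time of entering [i] by a jump; it increases to
   E_s[T_i] as n tends to infinity when the rates are bounded.  The time spent
   in [s] before the first jump has mean 1 / exit_rate s. *)
Fixpoint mean_return_time (i : S) (n : nat) (s : S) : R :=
  if n is n'.+1 then
    (exit_rate s)^-1 +
    \sum_(a <- trans s)
      a.1 / exit_rate s * (if a.2 == i then 0 else mean_return_time i n' a.2)
  else 0.

Definition positive_recurrent_state (i : S) : Prop :=
  (return_prob i n i @[n --> \oo] --> (1 : R)) /\
  cvgn (fun n => mean_return_time i n i).

Definition positive_recurrent (E : set S) : Prop :=
  forall i, E i -> positive_recurrent_state i.

End ctmc.

Definition stationary {d : measure_display} {R : realType}
    {S : measurableType d} (trans : S -> seq (R * S)) (E : set S)
    (P : probability S R) : Prop :=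
  P E = 1%E /\
  forall (t : R) (A : set S), 0 <= t -> measurable A ->
    (\int[P]_s (transition_prob trans t s A)%:E)%E = P A.

(* [X n] is a random variable on the probability space [(T, P n)] *)
Definition cvg_in_distribution {d : measure_display} {R : realType}
    {T : measurableType d} (P : nat -> probability T R) (X : nat -> T -> R)
    (mu : probability (measurableTypeR R) R) : Prop :=
  forall g : R -> R, continuous g -> (exists M, forall x, `|g x| <= M) ->
    (\int[P n]_w (g (X n w))%:E)%E @[n --> \oo] -->
    (\int[mu]_x (g x)%:E)%E.

(* pairs (net inventory level, number of in-transit items), carrying the
   discrete sigma-algebra *)
Definition inv_state : Type := (int * nat)%type.

HB.instance Definition _ := Choice.on inv_state.
HB.instance Definition _ := isPointed.Build inv_state (0, 0%N).
HB.instance Definition _ := @isMeasurable.Build default_measure_display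
  inv_state discrete_measurable discrete_measurable0
  discrete_measurableC discrete_measurableU.

Section gbs.
Context {R : realType}.
Variables (beta r gamma f xs : R).

Definition pipeline_mean : R := r / beta.

Definition gbs_target (y : int) : R := pipeline_mean - gamma * (y%:~R - xs).

Definition gbs_trunc_target (y : int) : R :=
  Num.max (Num.min (gbs_target y) (pipeline_mean + f)) 0.

(* the ceiling is a nonnegative integer, so [absz] only changes its type *)
Definition gbs_order_level (y : int) : nat :=
  `|Num.ceil (gbs_trunc_target y)|%N.

(* at z = 0 the second transition has rate 0, so the value of [z.-1] there is
   irrelevant *)
Definition gbs_trans (s : inv_state) : seq (R * inv_state) :=
  let: (y, z) := s in
  [:: (r, (y - 1, maxn z (gbs_order_level (y - 1))));
      (beta * z%:R, (y + 1, maxn z.-1 (gbs_order_level (y + 1))))].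

(* The states (y, ceil (r / beta + f)) with y sufficiently negative communicate
   with each other, hence "reachable from all of them" is the same as
   "reachable from some of them". *)
Definition gbs_state_space : set inv_state :=
  [set s | exists y0 : int, forall y : int, y <= y0 ->
     reachable gbs_trans (y, `|Num.ceil (pipeline_mean + f)|%N) s].

End gbs.

(* Main.v *)
Require Import Defs.
From mathcomp Require Import all_boot all_order all_algebra.
From mathcomp Require Import all_classical all_reals all_analysis.
From mathcomp Require Import ring lra zify.
Import Order.TTheory GRing.Theory Num.Theory.
Import numFieldNormedType.Exports.
Local Open Scope classical_set_scope.
Local Open Scope ring_scope.

(* With x = y - xs, p = r / beta, T the truncated target and U = z - T >= 0,
   the drift of x is beta (z - p) = beta (U - gamma x) as long as the target is
   not truncated.  The excess U is a fast variable: away from 0 its own drift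
   is about - r, so L U^3 <= - r U^2 + O(r gamma^4), and the cubic term of
   V = x^2 + U^3 / (gamma p) absorbs the cross term 2 beta x U of L x^2.  When
   the target is truncated above, z - p >= f still pushes x up; when it is
   truncated at 0, the inventory position bound x + z <= p + f + 1 pushes x
   down.  Altogether L V <= C r - beta sqrt(gamma r) |x|, so that in
   stationarity E|x| / sqrt r <= C' / sqrt gamma, and it suffices to let gamma
   tend to infinity slowly, as in [gain].  The same V, with finite sublevel
   sets, gives positive recurrence, and the occupation measure of an excursion
   from a state is stationary once normalised. *)

(** * Recurrence of a chain killed on entering a state *)

(** The limits are claimed for every stationary law, so the moment bound has to hold for an
    arbitrary one, with no integrability of V known in advance. Stationarity is expressed by the
    exponential series of the generator L, which converges on [E] since the rates are bounded there.
    Its derivative at t = 0 gives an integral of L g equal to 0 for indicators g; the unbounded V is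
    reached by truncation. The power three and the factor 1 / (gamma p) are dictated by Young's
    inequality: L U^3 / (gamma p) contributes - beta U^2 / gamma, which pays for 2 x U <= U^2 /
    gamma + gamma x^2 and leaves half of the restoring term 2 gamma x^2. Then gamma x^2 + r >= 2
    sqrt(gamma r) |x| makes it linear. This linear rate survives the two truncations of the target
    when sqrt(gamma r) <= f and gamma sqrt(gamma r) <= p, and gamma^3 <= r keeps the error r gamma^4
    / (gamma p) of order r. These conditions, with gamma (f + 1) <= p / 2, limit the growth of
    gamma. *)

Section killed_chain.
Context {R : realType} {S : choiceType}.
Variables (trans : S -> seq (R * S)) (E : set S) (lo Lam : R).
Hypothesis trans_ge0 : forall s a, a \in trans s -> 0 <= a.1.
Hypothesis closedE : forall s s', E s -> step trans s s' -> E s'.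
Hypothesis lo_gt0 : 0 < lo.
Hypothesis exit_lo : forall s, E s -> lo <= exit_rate trans s.
Hypothesis exit_hi : forall s, E s -> exit_rate trans s <= Lam.

Lemma exit_gt0 s : E s -> 0 < exit_rate trans s.
Proof. by move=> /exit_lo; apply: lt_le_trans. Qed.

(** A transition of rate 0 may leave [E] but contributes nothing, so a comparison on [E] is
    enough. *)
Lemma rate_sum_le s (F G : S -> R) : E s ->
  (forall s', E s' -> F s' <= G s') ->
  \sum_(a <- trans s) a.1 * F a.2 <= \sum_(a <- trans s) a.1 * G a.2.
Proof.
move=> Es FG; rewrite !big_seq; apply: ler_sum => a ain.
have := trans_ge0 s a ain; rewrite le_eqVlt => /predU1P[<-|a0].
  by rewrite !mul0r.
rewrite ler_pM2l//; apply/FG/(closedE s) => //.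
by apply/hasP; exists a => //; rewrite a0 eqxx.
Qed.

Lemma rate_sum_cst s (c : R) :
  \sum_(a <- trans s) a.1 * c = exit_rate trans s * c.
Proof. by rewrite /exit_rate mulr_suml. Qed.

Variable i : S.

(* The expectation of [g] after one jump, on the event that the jump does not
   lead to [i]. *)
Definition killed (g : S -> R) (s : S) : R :=
  (exit_rate trans s)^-1 *
  \sum_(a <- trans s) a.1 * (if a.2 == i then 0 else g a.2).

Lemma killedE (g : S -> R) s : killed g s =
  \sum_(a <- trans s) a.1 / exit_rate trans s * (if a.2 == i then 0 else g a.2).
Proof. by rewrite /killed mulr_sumr; apply: eq_bigr => a _; ring. Qed.

Lemma killed_le (g h : S -> R) : (forall s, E s -> g s <= h s) ->
  forall s, E s -> killed g s <= killed h s.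
Proof.
move=> gh s Es; rewrite /killed ler_pM2l ?invr_gt0 ?exit_gt0//.
apply: (@rate_sum_le s (fun s' => if s' == i then 0 else g s')
  (fun s' => if s' == i then 0 else h s')) => // s' Es'.
by case: eqP => // _; exact: gh.
Qed.

Lemma killedD (g h : S -> R) s :
  killed (fun x => g x + h x) s = killed g s + killed h s.
Proof.
rewrite /killed -mulrDr -big_split/=; congr (_ * _).
by apply: eq_bigr => a _; case: ifP => _; rewrite ?mulr0 ?addr0// mulrDr.
Qed.

Lemma killedZ (c : R) (g : S -> R) s :
  killed (fun x => c * g x) s = c * killed g s.
Proof.
rewrite /killed mulrCA; congr (_ * _); rewrite mulr_sumr.
by apply: eq_bigr => a _; case: ifP => _; rewrite ?mulr0// mulrCA.
Qed.

Lemma killed0 s : killed (fun=> 0) s = 0.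
Proof.
by rewrite /killed big1 ?mulr0// => a _; case: ifP => _; rewrite mulr0.
Qed.

Lemma killed_sum n (F : nat -> S -> R) s :
  killed (fun x => \sum_(0 <= k < n) F k x) s = \sum_(0 <= k < n) killed (F k) s.
Proof.
elim: n => [|n IH].
  rewrite big_nil -[RHS](killed0 s); congr killed.
  by apply/funext => x; rewrite big_nil.
rewrite big_nat_recr//= -IH -killedD; congr killed.
by apply/funext => x; rewrite big_nat_recr.
Qed.

Lemma killed_ge0 (g : S -> R) : (forall s, E s -> 0 <= g s) ->
  forall s, E s -> 0 <= killed g s.
Proof. by move=> g0 s Es; rewrite -(killed0 s); exact: killed_le. Qed.

Lemma iter_killed_ge0 n (g : S -> R) : (forall s, E s -> 0 <= g s) ->
  forall s, E s -> 0 <= iter n killed g s.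
Proof. by move=> g0; elim: n => //= n; exact: killed_ge0. Qed.

Lemma iter_killed_le n (g h : S -> R) : (forall s, E s -> g s <= h s) ->
  forall s, E s -> iter n killed g s <= iter n killed h s.
Proof. by move=> gh; elim: n => //= n; exact: killed_le. Qed.

Lemma iter_killedZ n c (g : S -> R) s :
  iter n killed (fun x => c * g x) s = c * iter n killed g s.
Proof.
elim: n s => //= n IH s; rewrite -killedZ; congr killed.
by apply/funext => x; rewrite IH.
Qed.

Lemma killed1_le1 s : E s -> killed (fun=> 1) s <= 1.
Proof.
move=> Es; rewrite /killed -[leRHS](@mulVf _ (exit_rate trans s)) ?gt_eqF ?exit_gt0//.
rewrite ler_pM2l ?invr_gt0 ?exit_gt0// -[leRHS]mulr1 -rate_sum_cst.
apply: (@rate_sum_le s (fun s' => if s' == i then 0 else 1) (fun=> 1)) => // s' _.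
by case: ifP.
Qed.

(** [iter n killed (fun=> 1) s] is the probability that none of the first [n] jumps from [s] enters
    [i]. *)
Lemma survival_decr n s : E s ->
  iter n.+1 killed (fun=> 1) s <= iter n killed (fun=> 1) s.
Proof.
by move=> Es; rewrite iterSr; apply: iter_killed_le => // s'; exact: killed1_le1.
Qed.

Lemma survival_nonincr m n s : E s -> (m <= n)%N ->
  iter n killed (fun=> 1) s <= iter m killed (fun=> 1) s.
Proof.
move=> Es /subnK <-; elim: (n - m)%N => [//|k IH].
by rewrite addSn; apply: le_trans IH; exact: survival_decr.
Qed.

Lemma survival_le1 n s : E s -> iter n killed (fun=> 1) s <= 1.
Proof. by move=> Es; exact: (survival_nonincr 0 n s Es (leq0n n)). Qed.

(** The k-th term is the mean holding time after k jumps on the event that [i] has not been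
    entered. *)
Lemma mean_return_timeE n s : mean_return_time trans i n s =
  \sum_(0 <= k < n) iter k killed (fun x => (exit_rate trans x)^-1) s.
Proof.
elim: n s => [|n IH] s; first by rewrite big_nil.
rewrite big_nat_recl//=; congr (_ + _).
by rewrite -killed_sum killedE; apply: eq_bigr => a _; rewrite IH.
Qed.

Lemma return_probE n s : E s ->
  return_prob trans i n s = 1 - iter n killed (fun=> 1) s.
Proof.
move=> Es; suff : forall s, E s ->
    return_prob trans i n s + iter n killed (fun=> 1) s = 1.
  by move=> H; apply/esym/eqP; rewrite subr_eq eq_sym; apply/eqP/H.
elim: n {s Es} => [|n IH] s Es /=; first by rewrite add0r.
have q0 := exit_gt0 _ Es.
rewrite killedE -big_split/= -[RHS](@mulfV _ (exit_rate trans s)) ?gt_eqF//.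
rewrite {3}/exit_rate mulr_suml !big_seq; apply: eq_bigr => a ain.
have := trans_ge0 s a ain; rewrite le_eqVlt => /predU1P[<-|a0].
  by rewrite !mul0r addr0.
case: ifPn => ai; first by rewrite mulr1 mulr0 addr0.
have Ea : E a.2.
  by apply: (closedE s) => //; apply/hasP; exists a => //; rewrite a0 eqxx.
by rewrite -mulrDr IH// mulr1.
Qed.

(** Every edge has a positive rate, so the path is followed with positive probability. It must be
    nonempty, as [i] is entered only by a jump. *)
Lemma path_survival_lt1 s p : E s -> path (step trans) s p -> last s p = i ->
  (0 < size p)%N -> iter (size p) killed (fun=> 1) s < 1.
Proof.
elim: p s => // s1 p IH s Es /= /andP[ss1 pp] lp _.
have Es1 := closedE _ _ Es ss1.
case/hasP: ss1 => a ain /andP[a0 /eqP as1].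
rewrite /killed -[ltRHS](@mulVf _ (exit_rate trans s)) ?gt_eqF ?exit_gt0//.
rewrite ltr_pM2l ?invr_gt0 ?exit_gt0// -[ltRHS]mulr1 -rate_sum_cst.
pose F s' := if s' == i then 0 else iter (size p) killed (fun=> 1) s'.
have F1 s' : E s' -> F s' <= 1.
  by rewrite /F; case: ifP => // _; exact: survival_le1.
have Fa : F a.2 < 1.
  rewrite /F as1; case: ifPn => // s1i; apply: IH => //.
  by case: p lp s1i {pp F F1} => //= ->; rewrite eqxx.
rewrite (perm_big _ (perm_to_rem ain)) [ltRHS](perm_big _ (perm_to_rem ain))/=.
rewrite !big_cons; apply: ltr_leD; first by rewrite ltr_pM2l.
rewrite !big_seq; apply: ler_sum => b /mem_rem bin.
have := trans_ge0 s b bin; rewrite le_eqVlt => /predU1P[<-|b0].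
  by rewrite !mul0r.
rewrite ler_pM2l//; apply/F1/(closedE s) => //.
by apply/hasP; exists b => //; rewrite b0 eqxx.
Qed.

(** Survival is nonincreasing in the number of jumps, so the largest horizon and the smallest
    entrance probability serve all states of [C]; the witness is the pair of the two. *)
Lemma uniform_survival_lt1 :
  (forall s, E s -> exists n, iter n killed (fun=> 1) s < 1) ->
  forall C : seq S, (forall s, s \in C -> E s) ->
  exists2 m, 0 < m.2 & forall s, s \in C ->
    iter m.1 killed (fun=> 1) s <= 1 - m.2 :> R.
Proof.
move=> reachi; elim=> [_|s C IH CE]; first by exists (0%N, 1) => /=.
have [|[m p]/= p0 mp] := IH; first by move=> x xC; apply: CE; rewrite inE xC orbT.
have Es : E s by apply: CE; rewrite mem_head.
have [n ns] := reachi s Es.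
exists (maxn n m, Num.min p (1 - iter n killed (fun=> 1) s)) => /=.
  by rewrite lt_min p0 subr_gt0.
move=> x; rewrite inE => /predU1P[->|xC].
  apply: (le_trans (survival_nonincr _ _ _ Es (leq_maxl _ _))).
  by rewrite lerBrDl -lerBrDr ge_min lexx orbT.
have Ex : E x by apply: CE; rewrite inE xC orbT.
apply: (le_trans (survival_nonincr _ _ _ Ex (leq_maxr _ _))).
by apply: (le_trans (mp x xC)); rewrite lerB// ge_min lexx.
Qed.

Section superharmonic.
Variable W : S -> R.
Hypothesis W_ge0 : forall s, E s -> 0 <= W s.
Hypothesis W_drift : forall s, E s ->
  (exit_rate trans s)^-1 + killed W s <= W s.

Lemma mean_return_time_le n s : E s -> mean_return_time trans i n s <= W s.
Proof.
rewrite mean_return_timeE.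
elim: n s => [|n IH] s Es; first by rewrite big_nil W_ge0.
apply: le_trans (W_drift s Es); rewrite big_nat_recl//= lerD2l.
by rewrite -killed_sum; exact: killed_le.
Qed.

(** Each holding time has mean at least 1 / Lam, so the mean number of jumps is at most [Lam] times
    the mean time. *)
Lemma survival_sum_le n s : E s ->
  \sum_(0 <= k < n) iter k killed (fun=> 1) s <= Lam * W s.
Proof.
move=> Es; have L0 : 0 < Lam by rewrite (lt_le_trans (exit_gt0 s Es)) ?exit_hi.
apply: le_trans (ler_wpM2l (ltW L0) (mean_return_time_le n s Es)).
rewrite mean_return_timeE mulr_sumr; apply: ler_sum => k _.
rewrite -iter_killedZ; apply: iter_killed_le => // x Ex.
by rewrite ler_pdivlMr ?exit_gt0// mul1r exit_hi.
Qed.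

Lemma survival_cvg0 s : E s -> iter n killed (fun=> 1) s @[n --> \oo] --> (0 : R).
Proof.
move=> Es; set u := fun n => _.
have u0 n : 0 <= u n by exact: iter_killed_ge0.
apply: (@cvg_series_cvg_0 _ R^o u).
apply: nondecreasing_is_cvgn; first exact: nondecreasing_series.
by exists (Lam * W s) => _ [n _ <-]; exact: survival_sum_le.
Qed.

Lemma positive_recurrent_of_superharmonic : E i ->
  positive_recurrent_state trans i.
Proof.
move=> Ei; split.
  rewrite (_ : (fun n => _) = fun n => 1 - iter n killed (fun=> 1) i); last first.
    by apply/funext => n; rewrite return_probE.
  rewrite -[X in _ --> X]subr0; apply: cvgB; first exact: cvg_cst.
  exact: survival_cvg0.
apply: nondecreasing_is_cvgn.
  apply/nondecreasing_seqP => n; rewrite !mean_return_timeE big_nat_recr//= lerDl.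
  by apply: iter_killed_ge0 => // x /exit_gt0; rewrite invr_ge0 => /ltW.
by exists (W i) => _ [n _ <-]; exact: mean_return_time_le.
Qed.

End superharmonic.

(* [W] is [V] plus a multiple of the mean number of jumps among the first [m]
   made before entering [i]; the latter has a strictly negative drift on the
   finite set where the drift of [V] may be nonnegative. *)
Lemma superharmonic_of_drift (V phi : S -> R) (d : R) :
  (forall s s', E s -> E s' -> reachable trans s s') -> E i -> 0 <= d ->
  (forall s, E s -> 0 <= V s) -> (forall s, E s -> 0 <= phi s) ->
  (forall s, E s -> generator trans V s <= d - phi s) ->
  finite_set [set s | E s /\ phi s < d + 1] ->
  exists W : S -> R, (forall s, E s -> 0 <= W s) /\
    forall s, E s -> (exit_rate trans s)^-1 + killed W s <= W s.
Proof.
move=> irr Ei d0 V0 phi0 drift /finite_seqP[C CE].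
(* One jump is made before [irr] is applied, so that the path is nonempty even when [s] is [i]. *)
have reachi s : E s -> exists n, iter n killed (fun=> 1) s < 1.
  move=> Es; have := gt_eqF (exit_gt0 _ Es); move/negbT.
  rewrite /exit_rate big_seq psumr_neq0; last exact: trans_ge0.
  case/hasP => a ain /andP[_ a0].
  have sa : step trans s a.2 by apply/hasP; exists a => //; rewrite a0 eqxx.
  have [p [ap lp]] := irr _ _ (closedE _ _ Es sa) Ei.
  by exists (size (a.2 :: p)); apply: path_survival_lt1; rewrite //= sa.
have CE' s : s \in C -> E s.
  by move=> sC; have : [set` C] s by []; rewrite -CE => -[].
have [[m p]/= p0 mp] := uniform_survival_lt1 reachi C CE'.
pose h s := \sum_(0 <= k < m) iter k killed (fun=> 1) s.
(* [c * p = (d + 1) / lo] dominates [(1 + d - phi s) / exit_rate trans s], and one killed jump from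
   a state of [C] lowers [c * h] by at least [c * p]. *)
pose c := (d + 1) / (lo * p).
have c0 : 0 <= c by rewrite divr_ge0// ?addr_ge0// mulr_ge0// ltW.
exists (fun s => V s + c * h s); split=> s Es.
  rewrite addr_ge0 ?V0// mulr_ge0// sumr_ge0// => k _.
  by apply: iter_killed_ge0.
have q0 := exit_gt0 s Es.
have kV : killed V s <= V s + (exit_rate trans s)^-1 * (d - phi s).
  rewrite -(ler_pM2l q0) /killed mulrDr !mulVKf ?gt_eqF//.
  apply: le_trans (lerD (lexx _) (drift s Es)).
  rewrite /generator.
  under [X in _ <= _ + X]eq_bigr do rewrite mulrBr.
  rewrite sumrB rate_sum_cst addrC subrK.
  apply: (rate_sum_le s (fun s' => if s' == i then 0 else V s') V Es) => s' Es'.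
  by case: ifP => // _; exact: V0.
(* [h] is a partial sum of survival probabilities, and [killed] shifts it by one index. *)
have kh : killed h s = h s - 1 + iter m killed (fun=> 1) s.
  rewrite killed_sum; apply/eqP; rewrite addrAC eq_sym subr_eq; apply/eqP.
  by rewrite /h -big_nat_recr// big_nat_recl// addrC.
rewrite killedD killedZ kh.
suff H : (exit_rate trans s)^-1 * (1 + d - phi s) <=
    c * (1 - iter m killed (fun=> 1) s) by lra.
have v1 := survival_le1 m s Es.
have [sd|phid] := ltP (phi s) (d + 1).
  have sC : s \in C by have : [set` C] s by rewrite -CE.
  have -> : 1 + d - phi s = d + 1 - phi s by ring.
  apply: (@le_trans _ _ (c * p)); last by rewrite ler_wpM2l//; have := mp s sC; lra.
  have -> : c * p = lo^-1 * (d + 1) by rewrite /c; field; rewrite !gt_eqF.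
  apply: ler_pM => //; first by rewrite invr_ge0 ltW.
  - by rewrite subr_ge0 ltW.
  - by rewrite lef_pV2 ?posrE// exit_lo.
  - by rewrite lerBlDr lerDl phi0.
apply: (@le_trans _ _ 0); last by rewrite mulr_ge0// subr_ge0.
by rewrite mulr_ge0_le0 ?invr_ge0 ?(ltW q0)//; lra.
Qed.

End killed_chain.

(** * Stationary laws and the generator *)

Lemma cvgn_norm_le {R : realType} (u : nat -> R) (l c : R) :
  u n @[n --> \oo] --> l -> (\forall n \near \oo, `|u n| <= c) -> `|l| <= c.
Proof.
move=> ul uc; have ul' : `|u n| @[n --> \oo] --> `|l| by exact: cvg_norm.
rewrite -(cvg_lim (@Rhausdorff R) ul'); apply: limr_le => //.
by apply/cvg_ex; exists `|l|.
Qed.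

Section stationarity.
Context {d : measure_display} {R : realType} {S : measurableType d}.
Variables (trans : S -> seq (R * S)) (E : set S) (Lam : R).
Hypothesis measS : forall A : set S, measurable A.
Hypothesis trans_ge0 : forall s a, a \in trans s -> 0 <= a.1.
Hypothesis closedE : forall s s', E s -> step trans s s' -> E s'.
Hypothesis exit_hi : forall s, E s -> exit_rate trans s <= Lam.
Hypothesis Lam_ge0 : 0 <= Lam.

Lemma discrete_measurable_fun {d'} {U : sigmaRingType d'} (D : set S) (f : S -> U) :
  measurable_fun D f.
Proof. by move=> _ A _; exact: measS. Qed.

(** This operator bound makes the series defining [transition_prob] converge on [E], dominated by
    that of exp (2 Lam t). *)
Lemma generator_bound (g : S -> R) (c : R) : (forall s, E s -> `|g s| <= c) ->
  forall s, E s -> `|generator trans g s| <= 2 * Lam * c.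
Proof.
move=> gc s Es; have c0 : 0 <= c by rewrite (le_trans _ (gc s Es)).
apply: (@le_trans _ _ (exit_rate trans s * (2 * c))); last first.
  by rewrite mulrCA mulrA ler_wpM2r// ler_wpM2l// exit_hi.
rewrite /exit_rate mulr_suml; apply: (le_trans (ler_norm_sum _ _ _)).
rewrite !big_seq; apply: ler_sum => a ain; have := trans_ge0 s a ain.
rewrite normrM le_eqVlt => /predU1P[<-|a0]; first by rewrite normr0 !mul0r.
rewrite gtr0_norm// ler_pM2l// (le_trans (ler_normB _ _))// mulr2n mulrDl mul1r.
rewrite lerD ?gc//; apply: (closedE s) => //.
by apply/hasP; exists a => //; rewrite a0 eqxx.
Qed.

Lemma indic_bound (A : set S) (s : S) : `|\1_A s : R| <= 1.
Proof. by rewrite indicE; case: (_ \in _); rewrite ?normr0 ?normr1. Qed.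

Lemma iter_generator_bound k (A : set S) s : E s ->
  `|iter k (generator trans) (\1_A) s| <= (2 * Lam) ^+ k.
Proof.
elim: k s => [|k IH] s Es /=; first by rewrite expr0 indic_bound.
by rewrite exprS; exact: generator_bound.
Qed.

Lemma generatorD (g h : S -> R) s :
  generator trans (fun x => g x + h x) s = generator trans g s + generator trans h s.
Proof.
by rewrite /generator -big_split/=; apply: eq_bigr => a _; ring.
Qed.

Lemma generatorZ c (g : S -> R) s :
  generator trans (fun x => c * g x) s = c * generator trans g s.
Proof. by rewrite /generator mulr_sumr; apply: eq_bigr => a _; ring. Qed.

Lemma generator_cst c s : generator trans (fun=> c) s = 0.
Proof. by rewrite /generator big1// => a _; rewrite subrr mulr0. Qed.

Definition transition_term (t : R) (A : set S) (k : nat) (s : S) : R :=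
  t ^+ k / k`!%:R * iter k (generator trans) (\1_A) s.

Lemma transition_term_bound t A k s : 0 <= t -> E s ->
  `|transition_term t A k s| <= exp_coeff (2 * Lam * t) k.
Proof.
move=> t0 Es; rewrite /transition_term /exp_coeff/= normrM.
rewrite ger0_norm ?divr_ge0 ?exprn_ge0//.
rewrite [leRHS](_ : _ = t ^+ k / k`!%:R * (2 * Lam) ^+ k); last first.
  by rewrite [in LHS]exprMn; ring.
by rewrite ler_wpM2l ?divr_ge0 ?exprn_ge0// iter_generator_bound.
Qed.

Lemma exp_coeff_sum_le (x : R) m n : 0 <= x ->
  \sum_(m <= k < n) exp_coeff x k <= expR x.
Proof.
move=> x0; have e0 k : 0 <= exp_coeff x k by rewrite exp_coeff_ge0.
apply: (@le_trans _ _ (series (exp_coeff x) n)).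
  rewrite /series/=; have [mn|/ltnW nm] := leqP m n; last first.
    by rewrite big_geq// sumr_ge0.
  by rewrite [leRHS](big_cat_nat _ mn)//= lerDr sumr_ge0.
apply: nondecreasing_cvgn_le; last exact: is_cvg_series_exp_coeff.
exact: nondecreasing_series.
Qed.

Lemma transition_sum_bound t A m n s : 0 <= t -> E s ->
  `|\sum_(m <= k < n) transition_term t A k s| <= expR (2 * Lam * t).
Proof.
move=> t0 Es; apply: (le_trans (ler_norm_sum _ _ _)).
apply: (le_trans (ler_sum _ (fun k _ => transition_term_bound t A k s t0 Es))).
by rewrite exp_coeff_sum_le// !mulr_ge0.
Qed.

Lemma transition_prob_cvg t A s : 0 <= t -> E s ->
  \sum_(0 <= k < n) transition_term t A k s @[n --> \oo] -->
  transition_prob trans t s A.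
Proof.
move=> t0 Es; apply: (@normed_cvg _ R^o (fun k => transition_term t A k s)).
apply: (@series_le_cvg _ _ (exp_coeff (2 * Lam * t))) => //.
- by move=> n /=.
- by move=> n; rewrite exp_coeff_ge0// !mulr_ge0.
- by move=> n; exact: transition_term_bound.
- exact: is_cvg_series_exp_coeff.
Qed.

Lemma transition_prob_bound t A s : 0 <= t -> E s ->
  `|transition_prob trans t s A| <= expR (2 * Lam * t).
Proof.
move=> t0 Es; apply: (cvgn_norm_le _ _ _ (transition_prob_cvg t A s t0 Es)).
by apply: nearW => n; exact: transition_sum_bound.
Qed.

(** The first two terms of the series are split off; in the others t^k <= t^2 because t <= 1. *)
Lemma transition_prob_taylor t A s : 0 <= t -> t <= 1 -> E s ->
  `|transition_prob trans t s A - (\1_A s + t * generator trans (\1_A) s)|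
    <= t ^+ 2 * expR (2 * Lam).
Proof.
move=> t0 t1 Es; set a := (X in _ - X).
have cv : \sum_(0 <= k < n) transition_term t A k s - a @[n --> \oo] -->
    transition_prob trans t s A - a.
  by apply: cvgB; [exact: transition_prob_cvg|exact: cvg_cst].
apply: (cvgn_norm_le _ _ _ cv).
exists 2%N => // n /= n2; rewrite (big_cat_nat _ n2)//=.
have -> : \sum_(0 <= k < 2) transition_term t A k s = a.
  rewrite big_nat_recr//= big_nat1 /transition_term/= /a.
  by rewrite expr0 expr1 !fact0 !divr1 mul1r.
rewrite addrAC subrr add0r; apply: (le_trans (ler_norm_sum _ _ _)).
apply: (@le_trans _ _ (t ^+ 2 * \sum_(2 <= k < n) exp_coeff (2 * Lam) k)); last first.
  by rewrite ler_wpM2l ?sqr_ge0// exp_coeff_sum_le// mulr_ge0.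
rewrite mulr_sumr !big_nat; apply: ler_sum => k /andP[k2 _].
rewrite /transition_term normrM ger0_norm ?divr_ge0 ?exprn_ge0//.
rewrite [leRHS](_ : _ = t ^+ 2 / k`!%:R * (2 * Lam) ^+ k); last first.
  by rewrite /exp_coeff/=; ring.
apply: ler_pM => //; first by rewrite divr_ge0 ?exprn_ge0.
  by rewrite ler_wpM2r ?invr_ge0// ler_wiXn2l.
exact: iter_generator_bound.
Qed.

Section integrals.
Variable P : probability S R.
Hypothesis PE : P E = 1%E.

Lemma integral_carrier (F : S -> \bar R) :
  (\int[P]_s F s = \int[P]_(s in E) F s)%E.
Proof.
rewrite [RHS]integral_mkcond; apply: ae_eq_integral => //.
exists (~` E); split => //.
  by have := probability_setC P (measS E); rewrite PE subee.
by move=> s /= H Es; apply: H => _; rewrite patchE mem_set.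
Qed.

Lemma bounded_integrable (g : S -> R) c : (forall s, E s -> `|g s| <= c) ->
  P.-integrable E (EFin \o g).
Proof.
move=> gc; apply: measurable_bounded_integrable => //.
- by rewrite [X in (X < _)%E]PE ltry.
- exists c; split; first exact: num_real.
  by move=> x cx s /= Es; rewrite (le_trans (gc s Es))// ltW.
Qed.

Lemma Rintegral_carrier_cst c : \int[P]_(s in E) (c : R) = c.
Proof. by rewrite Rintegral_cst// [X in fine X]PE mulr1. Qed.

Lemma Rintegral_indic A : (\int[P]_(s in E) \1_A s)%:E = P A.
Proof.
rewrite /Rintegral fineK; last first.
  apply: integrable_fin_num => //.
  by apply: (@bounded_integrable _ 1) => s _; exact: indic_bound.
by rewrite -integral_carrier integral_indic// setIT.
Qed.

Lemma transition_prob_integral t A : 0 <= t ->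
  (\int[P]_s (transition_prob trans t s A)%:E)%E =
  (\int[P]_(s in E) transition_prob trans t s A)%:E.
Proof.
move=> t0; rewrite integral_carrier /Rintegral fineK//.
apply: integrable_fin_num => //; apply: bounded_integrable => s Es.
exact: transition_prob_bound.
Qed.

(** Every term of the series after the first is a multiple of the generator applied to a function
    bounded on [E], so it integrates to 0. Only the integral of [\1_A] remains, and dominated
    convergence gives the limit. *)
Lemma stationary_of_invariant :
  (forall g c, (forall s, E s -> `|g s| <= c) ->
    \int[P]_(s in E) generator trans g s = 0) ->
  stationary trans E P.
Proof.
move=> inv; split=> // t A t0 _; rewrite integral_carrier.
pose u n s := (\sum_(0 <= k < n) transition_term t A k s)%:E.
have iu n : P.-integrable E (u n).
  apply: (@bounded_integrable _ (expR (2 * Lam * t))) => s Es.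
  exact: transition_sum_bound.
have Iu n : (0 < n)%N -> (\int[P]_(s in E) u n s = P A)%E.
  case: n => // n _; elim: n => [|n IH].
    rewrite -Rintegral_indic /Rintegral fineK; last first.
      apply: integrable_fin_num => //.
      by apply: (@bounded_integrable _ 1) => s _; exact: indic_bound.
    apply: eq_integral => s _; rewrite /u big_nat1 /transition_term/=.
    by rewrite expr0 fact0 divr1 mul1r.
  rewrite -IH.
  transitivity (\int[P]_(s in E) (u n.+1 s + (transition_term t A n.+1 s)%:E))%E.
    by apply: eq_integral => s _; rewrite /u big_nat_recr//= EFinD.
  have it : P.-integrable E (EFin \o transition_term t A n.+1).
    apply: bounded_integrable => s Es; exact: transition_term_bound.
  rewrite integralD//= -[RHS]adde0; congr (_ + _)%E.
  rewrite -[LHS]fineK ?integrable_fin_num//.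
  rewrite (_ : fine _ = \int[P]_(s in E) transition_term t A n.+1 s)//.
  have iL : P.-integrable E (EFin \o iter n.+1 (generator trans) \1_A).
    by apply: (@bounded_integrable _ ((2 * Lam) ^+ n.+1)) => s Es; exact: iter_generator_bound.
  rewrite /transition_term RintegralZl//.
  rewrite (inv (iter n (generator trans) \1_A) ((2 * Lam) ^+ n)) ?mulr0//.
  by move=> s Es; exact: iter_generator_bound.
have [|||||] := @dominated_convergence _ _ _ P E (measS E) u
  (fun s => (transition_prob trans t s A)%:E)
  (cst (expR (2 * Lam * t))%:E).
- by move=> n; exact: discrete_measurable_fun.
- exact: discrete_measurable_fun.
- apply: aeW => s Es; apply/cvg_EFin.
    by apply: nearW.
  exact: transition_prob_cvg.
- by apply: (@bounded_integrable _ (expR (2 * Lam * t))) => s _; rewrite ger0_norm// expR_ge0.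
- apply: aeW => s n Es; rewrite /u/= lee_fin; exact: transition_sum_bound.
move=> _ _ /cvg_lim <-//; apply: lim_near_cst => //.
by exists 1%N => // n n1; exact: Iu.
Qed.

Hypothesis Pst : stationary trans E P.

(* Stationarity over a time [t] makes [t] times this integral [O(t ^ 2)]. *)
Lemma invariant_indic A : \int[P]_(s in E) generator trans (\1_A) s = 0.
Proof.
have bI : forall s, E s -> `|\1_A s : R| <= 1 by move=> s _; exact: indic_bound.
have iI := @bounded_integrable _ _ bI.
have iG := @bounded_integrable _ _ (@generator_bound _ _ bI).
set J := \int[P]_(s in E) _.
have key t : 0 < t -> t <= 1 -> `|J| <= t * expR (2 * Lam).
  move=> t0 t1.
  have bT : forall s, E s -> `|transition_prob trans t s A| <= expR (2 * Lam * t).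
    by move=> s; apply: transition_prob_bound; rewrite ltW.
  have iT := @bounded_integrable _ _ bT.
  have iZ : P.-integrable E (EFin \o (fun s => t * generator trans (\1_A) s)).
    apply: (@bounded_integrable _ (t * (2 * Lam * 1))) => s Es.
    by rewrite normrM gtr0_norm// ler_pM2l// generator_bound.
  have iS : P.-integrable E (EFin \o (fun s => \1_A s + t * generator trans (\1_A) s)).
    exact: (integrableD (measS E) iI iZ).
  have iB : P.-integrable E (EFin \o (fun s => transition_prob trans t s A -
      (\1_A s + t * generator trans (\1_A) s))).
    apply: bounded_integrable => s Es; apply: transition_prob_taylor => //.
    exact: ltW.
  have eqJ : t * J = - \int[P]_(s in E) (transition_prob trans t s A -
      (\1_A s + t * generator trans (\1_A) s)).
    rewrite RintegralB// RintegralD// RintegralZl// -/J.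
    have -> : \int[P]_(s in E) transition_prob trans t s A =
        \int[P]_(s in E) \1_A s.
      apply: EFin_inj; rewrite Rintegral_indic -transition_prob_integral ?(ltW t0)//.
      by apply: Pst.2 => //; rewrite ltW.
    by ring.
  rewrite -(ler_pM2l t0) -[t in leLHS]gtr0_norm// -normrM eqJ normrN.
  apply: le_trans (le_normr_Rintegral _ iB) _ => //.
  rewrite mulrA -expr2 -[leRHS]Rintegral_carrier_cst.
  apply: le_Rintegral => //.
  - apply: (@bounded_integrable _ (t ^+ 2 * expR (2 * Lam))) => s Es.
    by rewrite normr_id transition_prob_taylor// ltW.
  - by apply: (@bounded_integrable _ `|t ^+ 2 * expR (2 * Lam)|).
  - by move=> s Es; rewrite transition_prob_taylor// ltW.
apply/eqP; rewrite -normr_le0; apply/ler_addgt0Pr => e e0; rewrite add0r.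
have x0 : 0 < expR (2 * Lam) := expR_gt0 _.
have := key (Num.min 1 (e / expR (2 * Lam))).
rewrite lt_min ltr01 divr_gt0// ge_min lexx => /(_ isT isT) /le_trans; apply.
by rewrite -ler_pdivlMr// ge_min lexx orbT.
Qed.

End integrals.
End stationarity.

(** * Moment bounds from a drift inequality *)

Section moments.
Context {d : measure_display} {R : realType} {S : measurableType d}.
Variables (trans : S -> seq (R * S)) (E : set S) (Lam : R).
Hypothesis measS : forall A : set S, measurable A.
Hypothesis trans_ge0 : forall s a, a \in trans s -> 0 <= a.1.
Hypothesis closedE : forall s s', E s -> step trans s s' -> E s'.
Hypothesis exit_hi : forall s, E s -> exit_rate trans s <= Lam.
Hypothesis Lam_ge0 : 0 <= Lam.
Variable P : probability S R.
Hypothesis Pst : stationary trans E P.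

(** A maximum principle: the value at [s] is shared, so only the values after a jump are
    compared. *)
Lemma generator_le (g h : S -> R) s : E s -> g s = h s ->
  (forall s', E s' -> g s' <= h s') -> generator trans g s <= generator trans h s.
Proof.
move=> Es gh glh; apply: (rate_sum_le trans E trans_ge0 closedE s
  (fun x => g x - g s) (fun x => h x - h s) Es) => s' Es'.
by rewrite gh lerB// glh.
Qed.

Lemma invariant_sum (C : seq S) (c : S -> R) :
  \int[P]_(s in E) generator trans (fun x => \sum_(z <- C) c z * \1_[set z] x) s = 0.
Proof.
have PE := Pst.1.
have b1 (z : S) (s : S) (Es : E s) := @indic_bound d R S [set z] s.
elim: C => [|z C IH].
  rewrite -[RHS](Rintegral_carrier_cst _ measS _ PE 0); apply: eq_Rintegral => s _.
  rewrite -[RHS](generator_cst trans 0 s); congr generator.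
  by apply/funext => x; rewrite big_nil.
pose g x := \sum_(z <- C) c z * \1_[set z] x.
have bg s : E s -> `|g s| <= \sum_(z <- C) `|c z|.
  move=> Es; apply: (le_trans (ler_norm_sum _ _ _)); apply: ler_sum => y _.
  by rewrite normrM ler_piMr// b1.
have bG := generator_bound _ _ _ trans_ge0 closedE exit_hi _ _ bg.
have bZ := generator_bound _ _ _ trans_ge0 closedE exit_hi _ _ (b1 z).
have iZ := bounded_integrable _ measS _ PE _ _ bZ.
transitivity (\int[P]_(s in E)
    (c z * generator trans (\1_[set z]) s + generator trans g s)).
  apply: eq_Rintegral => s _; rewrite -generatorZ -generatorD; congr generator.
  by apply/funext => x; rewrite big_cons.
rewrite RintegralD//; last exact: bounded_integrable bG.
  rewrite IH addr0 RintegralZl//.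
  rewrite (invariant_indic _ _ _ measS trans_ge0 closedE exit_hi Lam_ge0)//.
  by rewrite mulr0.
apply: (bounded_integrable _ measS _ PE _ (`|c z| * (2 * Lam * 1))) => s Es.
by rewrite normrM ler_wpM2l// bZ.
Qed.

Lemma finite_support_sum (C : seq S) (c : S -> R) x : uniq C ->
  \sum_(z <- C) c z * \1_[set z] x = if x \in C then c x else 0.
Proof.
move=> uC; case: ifPn => xC.
  rewrite (bigD1_seq x)//= indicE mem_set// mulr1 big1 ?addr0// => z zx.
  by rewrite indicE memNset ?mulr0//= => xz; rewrite xz eqxx in zx.
rewrite big_seq big1// => z zC; rewrite indicE memNset ?mulr0//= => xz.
by rewrite xz zC in xC.
Qed.

(* [V] may be unbounded; on [E] its truncation at [M] is a finitely supported
   function up to a constant, and truncation does not increase the drift. *)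
Lemma moment_bound (V phi : S -> R) (b : R) : 0 <= b ->
  (forall s, E s -> 0 <= V s) -> (forall s, E s -> 0 <= phi s) ->
  (forall s, E s -> generator trans V s <= b - phi s) ->
  (forall M : nat, finite_set [set s | E s /\ V s < M%:R]) ->
  (\int[P]_s (phi s)%:E <= b%:E)%E.
Proof.
move=> b0 V0 phi0 drift finV; have PE := Pst.1.
rewrite (integral_carrier _ measS _ PE).
pose h (M : nat) s : R := if V s < M%:R then phi s else 0.
have bound (M : nat) : (\int[P]_(s in E) (h M s)%:E <= b%:E)%E.
  have /finite_seqP[C0 C0E] := finV M.
  pose C := undup C0.
  have CE s : s \in C <-> E s /\ V s < M%:R.
    by rewrite mem_undup; split=> H; [have : [set` C0] s by []|
      have : [set s | E s /\ V s < M%:R] s by []]; rewrite ?C0E// -C0E.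
  (* On [E] this is min(V, M) - M: subtracting [M] makes the support finite without changing the
     generator. *)
  pose g s := \sum_(z <- C) (V z - M%:R) * \1_[set z] s.
  have gE s : E s -> g s = Num.min (V s) M%:R - M%:R.
    move=> Es; rewrite /g finite_support_sum ?undup_uniq//.
    case: ifPn => sC; first by have [_ ?] := (CE s).1 sC; rewrite min_l// ltW.
    rewrite min_r ?subrr// leNgt; apply/negP => VM; move/negP: sC; apply.
    exact/CE.
  have bg s : E s -> `|g s| <= M%:R.
    move=> Es; rewrite gE// ler_norml; have := V0 s Es.
    by have : 0 <= M%:R :> R by []; case: (leP (V s) M%:R); lra.
  have bG := generator_bound _ _ _ trans_ge0 closedE exit_hi _ _ bg.
  have iG := bounded_integrable _ measS _ PE _ _ bG.
  (* Where V < M the truncation touches V from below, so its generator is at most that of V;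
     elsewhere the truncation is at its maximum and its generator is at most 0. *)
  have hle s : E s -> h M s <= b - generator trans g s.
    move=> Es; rewrite /h; case: ifPn => [VM|]; last first.
      rewrite -leNgt => VM; rewrite subr_ge0 (le_trans _ b0)//.
      rewrite -(generator_cst trans 0 s); apply: generator_le => //.
        by rewrite gE// min_r// subrr.
      by move=> s' Es'; rewrite gE// subr_le0 ge_min lexx orbT.
    rewrite lerBrDr -lerBrDl; apply: le_trans (drift s Es).
    have -> : generator trans V s = generator trans (fun x => V x + (- M%:R)) s.
      by rewrite generatorD generator_cst addr0.
    apply: generator_le => //; first by rewrite gE// min_l// ltW.
    by move=> s' Es'; rewrite gE// lerB// ge_min lexx.
  apply: (@le_trans _ _ (\int[P]_(s in E) (b - generator trans g s)%:E)%E).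
    apply: ge0_le_integral => //.
    by move=> s Es; rewrite lee_fin /h; case: ifP => // _; exact: phi0.
  have ib : P.-integrable E (EFin \o (fun=> b)).
    by apply: (bounded_integrable _ measS _ PE _ `|b|).
  have iB : P.-integrable E (EFin \o (fun s => b - generator trans g s)).
    exact: (integrableB (measS E) ib iG).
  rewrite -[leLHS]fineK; last exact: (integrable_fin_num (measS E) iB).
  rewrite lee_fin -/(Rintegral P E (fun s => b - generator trans g s)).
  by rewrite RintegralB// (Rintegral_carrier_cst _ measS _ PE) invariant_sum subr0.
have h0 M s : E s -> (0 <= (h M s)%:E)%E.
  by move=> Es; rewrite lee_fin /h; case: ifP => // _; exact: phi0.
have hnd s : E s -> {homo (fun M => (h M s)%:E) : m n / (m <= n)%N >-> (m <= n)%E}.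
  move=> Es m n mn; rewrite lee_fin /h; case: ifPn => [Vm|_].
    by rewrite (lt_le_trans Vm) ?ler_nat.
  by case: ifP => // _; exact: phi0.
have <- : (\int[P]_(s in E) limn (fun M => (h M s)%:E) = \int[P]_(s in E) (phi s)%:E)%E.
  apply: eq_integral => s sE; apply: lim_near_cst => //.
  exists (Num.bound (V s)) => // n /= nV; rewrite /h ifT//.
  rewrite (lt_le_trans (archi_boundP _)) ?ler_nat//.
  by apply: V0; rewrite inE in sE.
rewrite monotone_convergence//; last by move=> n _ A _; exact: measS.
apply: lime_le.
  apply: ereal_nondecreasing_is_cvgn => m n mn.
  by apply: ge0_le_integral => // s Es; [exact: h0|exact: hnd].
by apply: nearW => M; exact: bound.
Qed.

End moments.

(** * Occupation measure of an excursion *)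

Section stationary_law.
Context {d : measure_display} {R : realType} {S : measurableType d}.
Variables (trans : S -> seq (R * S)) (E : set S) (lo Lam : R).
Hypothesis measS : forall A : set S, measurable A.
Hypothesis trans_ge0 : forall s a, a \in trans s -> 0 <= a.1.
Hypothesis closedE : forall s s', E s -> step trans s s' -> E s'.
Hypothesis lo_gt0 : 0 < lo.
Hypothesis exit_lo : forall s, E s -> lo <= exit_rate trans s.
Hypothesis exit_hi : forall s, E s -> exit_rate trans s <= Lam.
Variable i : S.

Let q := exit_rate trans.
Let K := killed trans i.
Let q_gt0 s : E s -> 0 < q s.
Proof. exact: exit_gt0 lo_gt0 exit_lo s. Qed.

(** Transitions are taken by position because [msum] needs an index; the default is not met below
    [size (trans s)]. The absolute values in [killed_law] provide nonnegative scalars at every [s]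
    and change nothing on [E]. *)
Definition killed_weight (s : S) (k : nat) : R :=
  let a := nth (0, s) (trans s) k in
  if a.2 == i then 0 else a.1 / exit_rate trans s.

(* The law of the state after [n] jumps on the event that [i] has not been
   entered, with density [1 / q], the mean holding time. *)
Fixpoint killed_law (n : nat) (s : S) : {measure set S -> \bar R} :=
  if n is n'.+1 then
    msum (fun k => mscale (NngNum (normr_ge0 (killed_weight s k)))
      (killed_law n' (nth (0, s) (trans s) k).2)) (size (trans s))
  else mscale (NngNum (normr_ge0 (exit_rate trans s)^-1)) (\d_s).

(** Reduces integrals against the occupation measure to limits of real series. *)
Lemma killed_lawE n s (g : S -> R) : E s -> (forall x, E x -> 0 <= g x) ->
  (\int[killed_law n s]_(x in E) (g x)%:E =
   (iter n K (fun x => (q x)^-1 * g x) s)%:E)%E.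
Proof.
move=> Es g0.
elim: n s Es => [|n IH] s Es /=.
  rewrite ge0_integral_mscale//=.
  rewrite integral_dirac// diracE mem_set// mul1e gtr0_norm ?invr_gt0 ?q_gt0//.
rewrite ge0_integral_measure_sum//=.
rewrite /K killedE (big_nth (0, s)) big_mkord -sumEFin.
apply: eq_bigr => k _.
rewrite ge0_integral_mscale//=.
rewrite /killed_weight; set a := nth _ _ _.
have ain : a \in trans s by rewrite mem_nth.
case: ifPn => ai; first by rewrite normr0 mul0e mulr0.
have := trans_ge0 s a ain; rewrite le_eqVlt => /predU1P[<-|a0].
  by rewrite !mul0r normr0 mul0e.
rewrite IH; last by apply: (closedE s) => //; apply/hasP; exists a; rewrite ?a0 ?eqxx.
by rewrite ger0_norm ?divr_ge0// ltW// q_gt0.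
Qed.

Lemma killed_law_setC n s : E s -> killed_law n s (~` E) = 0%E.
Proof.
elim: n s => [|n IH] s Es /=.
  by rewrite /mscale/= diracE memNset ?mule0//=; apply/contrapT.
rewrite /msum/= big1// => k _; rewrite /mscale/= /killed_weight.
set a := nth _ _ _.
have ain : a \in trans s by rewrite mem_nth.
case: ifPn => ai; first by rewrite normr0 mul0e.
have := trans_ge0 s a ain; rewrite le_eqVlt => /predU1P[<-|a0].
  by rewrite !mul0r normr0 mul0e.
by rewrite IH ?mule0//; apply: (closedE s) => //; apply/hasP; exists a; rewrite ?a0 ?eqxx.
Qed.

Hypothesis Ei : E i.

Definition occupation : {measure set S -> \bar R} := mseries (fun n => killed_law n i) 0.

Lemma iter_killed_eq n (g h : S -> R) s : E s -> (forall x, E x -> g x = h x) ->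
  iter n K g s = iter n K h s.
Proof.
by move=> Es gh; apply/le_anti/andP; split;
  apply: (iter_killed_le _ _ _ trans_ge0 closedE lo_gt0 exit_lo) => // x Ex; rewrite gh.
Qed.

Lemma iter_killedD n (g h : S -> R) s :
  iter n K (fun x => g x + h x) s = iter n K g s + iter n K h s.
Proof.
elim: n s => //= n IH s; rewrite -killedD; congr killed.
by apply/funext => x; rewrite IH.
Qed.

(* A jump is a killed jump or an entrance to [i], whence a telescoping sum. *)
Lemma killed_generator_sum (g : S -> R) n :
  \sum_(0 <= k < n) iter k K (fun x => (q x)^-1 * generator trans g x) i =
  iter n K g i - g i * iter n K (fun=> 1) i.
Proof.
elim: n => [|n IH]; first by rewrite big_nil /= mulr1 subrr.
rewrite big_nat_recr//= IH.
(* [K g] misses the jumps to [i], which have probability [1 - K (fun=> 1) x] and carry the value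
   [g i]. *)
have step_eq x : E x -> (q x)^-1 * generator trans g x =
    K g x + (g i * (1 - K (fun=> 1) x) - g x).
  move=> Ex; have q0 := gt_eqF (q_gt0 x Ex).
  apply: (mulfI (negbT q0)); rewrite mulVKf ?q0//.
  have qK h : q x * K h x = \sum_(a <- trans x) a.1 * (if a.2 == i then 0 else h a.2).
    by rewrite /K /killed mulVKf ?q0.
  have -> : q x * (K g x + (g i * (1 - K (fun=> 1) x) - g x)) =
      q x * K g x + (g i * (q x * 1 - q x * K (fun=> 1) x) - q x * g x) by ring.
  rewrite !qK -!rate_sum_cst -sumrB mulr_sumr -sumrB -big_split/=.
  by apply: eq_bigr => a _; case: eqP => [->|_]; ring.
rewrite (iter_killed_eq n _ _ i Ei step_eq) iter_killedD -iterSr/=.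
have -> : iter n K (fun x => g i * (1 - K (fun=> 1) x) - g x) i =
    g i * iter n K (fun=> 1) i - g i * K (iter n K (fun=> 1)) i - iter n K g i.
  have -> : (fun x => g i * (1 - K (fun=> 1) x) - g x) =
      (fun x => (g i * 1 + (- g i) * K (fun=> 1) x) + (-1) * g x).
    by apply/funext => x; ring.
  rewrite !iter_killedD !iter_killedZ -iterSr iterS -/K; ring.
ring.
Qed.

Variable W : S -> R.
Hypothesis W_ge0 : forall s, E s -> 0 <= W s.
Hypothesis W_drift : forall s, E s -> (q s)^-1 + K W s <= W s.

Lemma occupation_integral (g : S -> R) (l : R) : (forall x, E x -> 0 <= g x) ->
  \sum_(0 <= k < n) iter k K (fun x => (q x)^-1 * g x) i @[n --> \oo] --> l ->
  (\int[occupation]_(x in E) (g x)%:E)%E = l%:E.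
Proof.
move=> g0 gl; rewrite ge0_integral_measure_series//.
have gl' : (fun n => (\sum_(0 <= k < n) iter k K (fun x => (q x)^-1 * g x) i)%:E)
    @ \oo --> l%:E by apply: cvg_EFin => //; exact: nearW.
rewrite -(cvg_lim _ gl')//; congr (limn _); apply/funext => n.
by rewrite -sumEFin; apply: eq_bigr => k _; rewrite killed_lawE.
Qed.

(** The mean return time to [i], which is the total mass of the occupation measure. *)
Let mass := limn (fun n => mean_return_time trans i n i).

Let mass_cvg : mean_return_time trans i n i @[n --> \oo] --> mass.
Proof.
by have [] := positive_recurrent_of_superharmonic _ _ _ _ trans_ge0 closedE lo_gt0
  exit_lo exit_hi i W W_ge0 W_drift Ei.
Qed.

Let mass_gt0 : 0 < mass.
Proof.
have ge n : (0 < n)%N -> (q i)^-1 <= mean_return_time trans i n i.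
  case: n => // n _; rewrite mean_return_timeE big_nat_recl//= lerDl.
  apply: sumr_ge0 => k _.
  rewrite -iterS; apply: (iter_killed_ge0 _ _ _ trans_ge0 closedE lo_gt0 exit_lo) => //.
  by move=> s Es; rewrite invr_ge0 ltW// q_gt0.
apply: (@lt_le_trans _ _ (q i)^-1); first by rewrite invr_gt0 q_gt0.
by apply: limr_ge; [apply/cvg_ex; exists mass; exact: mass_cvg|exists 1%N].
Qed.

Lemma occupation_carrier : occupation E = mass%:E.
Proof.
rewrite -[LHS]mul1e -integral_cst//; apply: occupation_integral => //.
rewrite (_ : (fun n => _) = fun n => mean_return_time trans i n i)//.
apply/funext => n; rewrite mean_return_timeE; apply: eq_bigr => k _.
by congr (iter k K _ i); apply/funext => x; rewrite mulr1.
Qed.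

Lemma occupation_setC : occupation (~` E) = 0%E.
Proof. by rewrite /occupation/= /mseries eseries0// => n _ _; exact: killed_law_setC. Qed.

Lemma occupation_setT : occupation setT = mass%:E.
Proof.
rewrite -(setUv E) measureU ?setICr// [X in (_ + X)%E]occupation_setC adde0.
exact: occupation_carrier.
Qed.

Lemma stationary_exists : exists P : probability S R, stationary trans E P.
Proof.
(* The fallback [\d_i] concerns a total mass 0 or infinite; here the mass is positive and finite. *)
pose P : probability S R := mnormalize occupation (\d_i).
have PA A : P A = (occupation A * (mass^-1)%:E)%E.
  rewrite /P /= /mnormalize occupation_setT/= eqe gt_eqF ?mass_gt0//=.
have PE : P E = 1%E.
  by rewrite PA occupation_carrier -EFinM mulfV// gt_eqF ?mass_gt0.
have L0 : 0 <= Lam by rewrite (le_trans (ltW (q_gt0 i Ei))) ?exit_hi.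
exists P; apply: (stationary_of_invariant _ _ _ measS trans_ge0 closedE exit_hi) => //.
move=> g c gc.
have bG := generator_bound _ _ _ trans_ge0 closedE exit_hi _ _ gc.
set C := 2 * Lam * c in bG.
have iG := bounded_integrable _ measS _ PE _ _ bG.
have iC : P.-integrable E (EFin \o (fun=> C)).
  by apply: (bounded_integrable _ measS _ PE _ `|C|).
(* Adding [C] makes the integrand nonnegative, as [occupation_integral] requires. *)
suff H : \int[P]_(s in E) (generator trans g s + C) = C.
  move: H; rewrite RintegralD// (Rintegral_carrier_cst _ measS _ PE).
  by rewrite -[X in _ = X]add0r => /addIr.
have F0 x : E x -> 0 <= generator trans g x + C.
  by move=> Ex; have := bG x Ex; rewrite ler_norml => /andP[]; lra.
have occ : (\int[occupation]_(x in E) (generator trans g x + C)%:E)%E = (C * mass)%:E.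
  apply: occupation_integral => //.
  have -> : (fun n => \sum_(0 <= k < n)
        iter k K (fun x => (q x)^-1 * (generator trans g x + C)) i) =
      fun n => iter n K g i - g i * iter n K (fun=> 1) i +
        C * mean_return_time trans i n i.
    apply/funext => n; rewrite -killed_generator_sum mean_return_timeE mulr_sumr.
    rewrite -big_split/=; apply: eq_bigr => k _.
    rewrite -iter_killedZ -iter_killedD; congr (iter k K _ i).
    by apply/funext => x; rewrite mulrDr; congr (_ + _); rewrite mulrC.
  rewrite -[C * mass]add0r; apply: cvgD; last exact: cvgMr.
  (* Both boundary terms of the telescoped sum vanish in the limit: |g| <= c on [E] and survival
     tends to 0. *)
  have surv := survival_cvg0 _ _ _ _ trans_ge0 closedE lo_gt0
    exit_lo exit_hi i W W_ge0 W_drift i Ei.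
  rewrite -[X in _ --> X]subr0; apply: cvgB; last first.
    by rewrite -(mulr0 (g i)); exact: cvgMr.
  apply: (@squeeze_cvgr _ _ _ _ (fun n => - c * iter n K (fun=> 1) i)
      (fun n => c * iter n K (fun=> 1) i)).
  - apply: nearW => n; rewrite -!iter_killedZ; apply/andP.
    by split; apply: (iter_killed_le _ _ _ trans_ge0 closedE lo_gt0 exit_lo) => // x Ex;
      have := gc x Ex; rewrite ler_norml mulr1 => /andP[].
  - by rewrite -(mulr0 (- c)); exact: cvgMr.
  - by rewrite -(mulr0 c); exact: cvgMr.
have m0 : 0 <= mass^-1 by rewrite invr_ge0 ltW ?mass_gt0.
rewrite /Rintegral (eq_measure_integral (mscale (NngNum m0) occupation)); last first.
  by move=> A _ _; rewrite [LHS]PA /mscale/= muleC.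
rewrite ge0_integral_mscale//= occ /= mulrC mulfK//.
by rewrite gt_eqF ?mass_gt0.
Qed.

End stationary_law.

(** * Drift of the Lyapunov function *)

Section cubic_drift.
Context {R : realFieldType}.
Implicit Types r gamma U B : R.

(** After expansion the leading term is at most - (3/2) r U^2. A third of it absorbs the linear term
    9 r gamma^2 U at the cost of (81/2) r gamma^4, and the cubed jumps add at most 2 r gamma^4,
    whence 43. *)
Lemma cubic_drift_far r gamma U B : 0 <= r -> 1 <= gamma -> 0 <= U ->
  0 <= B -> B <= 2 * r -> B * (gamma - 1) <= r * gamma - r / 2 ->
  r * ((U - gamma) ^+ 3 - U ^+ 3) + B * ((U + gamma - 1) ^+ 3 - U ^+ 3) <=
  - r * U ^+ 2 + 43 * r * gamma ^+ 4.
Proof.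
move=> r0 g1 U0 B0 B2 Bg.
have g0 : 0 <= gamma by lra.
have h1 : 3 * U ^+ 2 * (B * (gamma - 1) - r * gamma) <= 3 * U ^+ 2 * (- (r / 2)).
  by rewrite ler_wpM2l ?mulr_ge0 ?sqr_ge0//; lra.
have h2 : B * (gamma - 1) ^+ 2 <= 2 * r * gamma ^+ 2.
  by apply: ler_pM; rewrite ?sqr_ge0// ler_sqr ?nnegrE; lra.
have h3 : B * (gamma - 1) ^+ 3 <= 2 * r * gamma ^+ 3.
  by apply: ler_pM; rewrite ?exprn_ge0// ?lerXn2r ?nnegrE; lra.
have h4 : 3 * U * (B * (gamma - 1) ^+ 2 + r * gamma ^+ 2) <=
    3 * U * (3 * r * gamma ^+ 2).
  by rewrite ler_wpM2l ?mulr_ge0//; lra.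
have h5 : r * gamma ^+ 3 <= r * gamma ^+ 4.
  by rewrite ler_wpM2l// ler_weXn2l.
have h6 : 0 <= r * (U - 9 * gamma ^+ 2) ^+ 2 by rewrite mulr_ge0 ?sqr_ge0.
have h7 : 0 <= r * gamma ^+ 3 by rewrite mulr_ge0 ?exprn_ge0.
have h8 : 0 <= r * gamma ^+ 4 by rewrite mulr_ge0 ?exprn_ge0.
have -> : r * ((U - gamma) ^+ 3 - U ^+ 3) + B * ((U + gamma - 1) ^+ 3 - U ^+ 3) =
  3 * U ^+ 2 * (B * (gamma - 1) - r * gamma) +
  3 * U * (B * (gamma - 1) ^+ 2 + r * gamma ^+ 2) +
  B * (gamma - 1) ^+ 3 - r * gamma ^+ 3 by ring.
have e6 : r * (U - 9 * gamma ^+ 2) ^+ 2 =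
  r * U ^+ 2 - 18 * (r * gamma ^+ 2 * U) + 81 * (r * gamma ^+ 4) by ring.
have e4 : 3 * U * (3 * r * gamma ^+ 2) = 9 * (r * gamma ^+ 2 * U) by ring.
have e1 : 3 * U ^+ 2 * (- (r / 2)) = - (3 / 2) * (r * U ^+ 2) by field.
rewrite e6 in h6; rewrite e4 in h4; rewrite e1 in h1.
lra.
Qed.

Lemma cubic_drift_near r gamma U U1 U2 B : 0 <= r -> 1 <= gamma -> 0 <= U ->
  U <= 2 * gamma -> 0 <= U1 -> U1 <= 2 * gamma -> 0 <= U2 -> U2 <= 2 * gamma ->
  0 <= B -> B <= 2 * r ->
  r * (U1 ^+ 3 - U ^+ 3) + B * (U2 ^+ 3 - U ^+ 3) <=
  - r * U ^+ 2 + 43 * r * gamma ^+ 4.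
Proof.
move=> r0 g1 U0 Ug U10 U1g U20 U2g B0 B2.
have g0 : 0 <= gamma by lra.
have c1 : U1 ^+ 3 <= 8 * gamma ^+ 3.
  by rewrite (_ : 8 * _ = (2 * gamma) ^+ 3) ?lerXn2r ?nnegrE ?mulr_ge0//; ring.
have c2 : U2 ^+ 3 <= 8 * gamma ^+ 3.
  by rewrite (_ : 8 * _ = (2 * gamma) ^+ 3) ?lerXn2r ?nnegrE ?mulr_ge0//; ring.
have c3 : U ^+ 2 <= 4 * gamma ^+ 2.
  by rewrite (_ : 4 * _ = (2 * gamma) ^+ 2) ?lerXn2r ?nnegrE ?mulr_ge0//; ring.
have u3 : 0 <= U ^+ 3 by rewrite exprn_ge0.
have g3 : 0 <= gamma ^+ 3 by rewrite exprn_ge0.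
have h1 : r * (U1 ^+ 3 - U ^+ 3) <= r * (8 * gamma ^+ 3) by rewrite ler_wpM2l//; lra.
have h2 : B * (U2 ^+ 3 - U ^+ 3) <= 2 * r * (8 * gamma ^+ 3).
  apply: (@le_trans _ _ (B * (8 * gamma ^+ 3))); first by rewrite ler_wpM2l//; lra.
  by rewrite ler_wpM2r// mulr_ge0.
have h3 : r * U ^+ 2 <= r * (4 * gamma ^+ 2) by rewrite ler_wpM2l.
have h4 : r * gamma ^+ 3 <= r * gamma ^+ 4 by rewrite ler_wpM2l// ler_weXn2l.
have h5 : r * gamma ^+ 2 <= r * gamma ^+ 4 by rewrite ler_wpM2l// ler_weXn2l.
have h6 : 0 <= r * gamma ^+ 4 by rewrite mulr_ge0 ?exprn_ge0.
lra.
Qed.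

End cubic_drift.

(** * The drift inequality in real variables *)

Section drift_inequality.
Context {R : realFieldType}.
Variables (beta gamma f p lam : R).
Hypothesis beta_gt0 : 0 < beta.
Hypothesis gamma_ge1 : 1 <= gamma.
Hypothesis f_gt0 : 0 < f.
Hypothesis p_gt0 : 0 < p.
Hypothesis lam_ge0 : 0 <= lam.
Hypothesis gamma_f : 2 * gamma * (f + 1) <= p.
Hypothesis lam_f : lam <= f.
Hypothesis lam_sqr : lam ^+ 2 = gamma * (beta * p).
Hypothesis lam_gamma : lam * gamma <= p.
Hypothesis gamma_cube : gamma ^+ 3 <= beta * p.
Hypothesis rate_ge1 : 1 <= beta * p.

Definition clamp (x : R) : R := Num.max (Num.min (p - gamma * x) (p + f)) 0.

Lemma clampP x :
  [\/ p + f <= p - gamma * x /\ clamp x = p + f,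
      0 <= p - gamma * x <= p + f /\ clamp x = p - gamma * x |
      p - gamma * x <= 0 /\ clamp x = 0].
Proof.
have pf : 0 < p + f by rewrite addr_gt0.
rewrite /clamp; case: (leP (p - gamma * x) (p + f)) => h1; last first.
  by constructor 1; split; [exact: ltW|rewrite max_l// ltW].
by case: (leP (p - gamma * x) 0) => h2; [constructor 3|constructor 2; rewrite ltW].
Qed.

Variables (x z U1 U2 : R).
Hypothesis z_ge : clamp x <= z.
Hypothesis z_lt : z < p + f + 1.
Hypothesis xz_le : x + z <= p + f + 1.
Hypothesis z_nat : z = 0 \/ 1 <= z.
Hypothesis U1_ge0 : 0 <= U1.
Hypothesis U1_le : U1 <= Num.max (z - clamp (x - 1)) 1.
Hypothesis U2_ge0 : 0 <= U2.
Hypothesis U2_le : U2 <= Num.max (z - 1 - clamp (x + 1)) 1.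

Let U := z - clamp x.

Let lin_clamp_sub : gamma * (x - 1) = gamma * x - gamma. Proof. ring. Qed.
Let lin_clamp_add : gamma * (x + 1) = gamma * x + gamma. Proof. ring. Qed.

(** [U1] and [U2] are the excess after a demand and after an item arrival. From U = gamma + 1 on,
    the rounding bound 1 is inactive and [cubic_drift_far] applies; below, all three values are at
    most 2 gamma. *)
Lemma cubic_drift : 0 < clamp x ->
  beta * p * (U1 ^+ 3 - U ^+ 3) + beta * z * (U2 ^+ 3 - U ^+ 3) <=
  - (beta * p) * U ^+ 2 + 43 * (beta * p) * gamma ^+ 4.
Proof.
move: gamma_ge1 f_gt0 p_gt0 lam_ge0 gamma_f lam_f lam_gamma z_ge z_lt xz_le =>
  g1 f0 p0 l0 gf lf lg zge zlt xzle.
move: gamma_cube rate_ge1 => gc r1.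
move=> T0; have g0 : 0 <= gamma by lra.
have z0 : 0 <= z by lra.
have U0 : 0 <= U by rewrite /U; lra.
have zp : z <= 2 * p.
  have : f + 1 <= gamma * (f + 1) by rewrite ler_peMl//; lra.
  by lra.
have bp0 : 0 <= beta * p by rewrite mulr_ge0// ltW.
have bz2 : beta * z <= 2 * (beta * p) by rewrite mulrCA ler_wpM2l// ltW.
have bz0 : 0 <= beta * z by rewrite mulr_ge0// ltW.
have Tsub : clamp x <= clamp (x - 1).
  move: (clampP x) (clampP (x - 1)); rewrite lin_clamp_sub.
  by move=> [[h ->]|[/andP[h h'] ->]|[h ->]] [[k ->]|[/andP[k k'] ->]|[k ->]]; lra.
have Tadd : clamp x - gamma <= clamp (x + 1).
  move: (clampP x) (clampP (x + 1)); rewrite lin_clamp_add.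
  by move=> [[h ->]|[/andP[h h'] ->]|[h ->]] [[k ->]|[/andP[k k'] ->]|[k ->]]; lra.
have [Uf|Un] := leP (gamma + 1) U.
  (* As z < p + f + 1 and U >= gamma + 1, the target is at least gamma below its cap; being
     positive, it rises by exactly gamma on a demand. *)
  have T1E : clamp (x - 1) = clamp x + gamma.
    move: T0 z_ge Uf; rewrite /U; move: (clampP x) (clampP (x - 1)).
    rewrite lin_clamp_sub.
    by move=> [[h ->]|[/andP[h h'] ->]|[h ->]] [[k ->]|[/andP[k k'] ->]|[k ->]] *; lra.
  have U1' : U1 <= U - gamma.
    move: U1_le; rewrite T1E max_l; rewrite /U in Uf *; lra.
  have U2' : U2 <= U + gamma - 1.
    apply: (le_trans U2_le); rewrite ge_max; rewrite /U in Uf *.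
    by apply/andP; split; lra.
  apply: le_trans (cubic_drift_far (beta * p) gamma U (beta * z) _ _ _ _ _ _) => //.
    apply: lerD.
      by rewrite ler_wpM2l// lerB// lerXn2r ?nnegrE//; lra.
    by rewrite ler_wpM2l// lerB// lerXn2r ?nnegrE//; lra.
  (* By [gamma_f], gamma (f + 1) <= p / 2 uses up at most half of the restoring drift. *)
  have : z * (gamma - 1) <= p * gamma - p / 2.
    have h : z * (gamma - 1) <= (p + f + 1) * (gamma - 1).
      by rewrite ler_wpM2r; lra.
    have h' : (p + f + 1) * (gamma - 1) = p * gamma + gamma * (f + 1) - p - (f + 1) by ring.
    lra.
  by rewrite -(ler_pM2l beta_gt0) => h; rewrite -mulrA (le_trans h)//; lra.
apply: cubic_drift_near => //.
- lra.
- apply: (le_trans U1_le); rewrite ge_max; apply/andP; split; last lra.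
  by rewrite /U in Un; lra.
- apply: (le_trans U2_le); rewrite ge_max; apply/andP; split; last lra.
  by rewrite /U in Un; lra.
Qed.

(** The excess is now [z] itself. An arrival does not raise it for z >= 1 and has rate 0 at z = 0; a
    demand exceeds [z] only through rounding, up to 1. *)
Lemma cubic_drift_zero : clamp x = 0 ->
  beta * p * (U1 ^+ 3 - U ^+ 3) + beta * z * (U2 ^+ 3 - U ^+ 3) <= beta * p.
Proof.
move: gamma_ge1 f_gt0 p_gt0 lam_ge0 gamma_f lam_f lam_gamma z_ge z_lt xz_le =>
  g1 f0 p0 l0 gf lf lg zge zlt xzle.
move: gamma_cube rate_ge1 => gc r1.
move=> T0; have z0 : 0 <= z by rewrite -T0.
have c0 y : 0 <= clamp y by rewrite /clamp le_max lexx orbT.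
have b0 := ltW beta_gt0.
have -> : U = z by rewrite /U T0 subr0.
have z3 : 0 <= z ^+ 3 by rewrite exprn_ge0.
have h2 : beta * z * (U2 ^+ 3 - z ^+ 3) <= 0.
  case: z_nat => [->|z1]; first by rewrite mulr0 mul0r.
  rewrite mulr_ge0_le0 ?mulr_ge0// subr_le0 lerXn2r ?nnegrE//.
  apply: (le_trans U2_le); rewrite ge_max z1 andbT.
  by have := c0 (x + 1); lra.
have h1 : U1 ^+ 3 - z ^+ 3 <= 1.
  have U1m : U1 <= Num.max z 1.
    apply: (le_trans U1_le); rewrite ge_max !le_max lexx orbT andbT.
    by apply/orP; left; have := c0 (x - 1); lra.
  have [z1|z1] := leP 1 z.
    rewrite max_l// in U1m; have : U1 ^+ 3 <= z ^+ 3 by rewrite lerXn2r ?nnegrE.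
    lra.
  rewrite max_r ?(ltW z1)// in U1m.
  have : U1 ^+ 3 <= 1 by rewrite exprn_ile1.
  lra.
have : beta * p * (U1 ^+ 3 - z ^+ 3) <= beta * p * 1.
  by rewrite ler_wpM2l// mulr_ge0// ltW.
lra.
Qed.

(** The square of gamma |x| - lam is nonnegative, and lam^2 / gamma = beta p. *)
Let quad_lower : gamma * x ^+ 2 >= 2 * lam * `|x| - beta * p.
Proof.
have g0 : 0 < gamma by rewrite (lt_le_trans ltr01).
rewrite -subr_ge0 -(pmulr_rge0 _ g0) -(real_normK (num_real x)).
have -> : gamma * (gamma * `|x| ^+ 2 - (2 * lam * `|x| - beta * p)) =
  (gamma * `|x|) ^+ 2 - 2 * lam * (gamma * `|x|) + gamma * (beta * p) by ring.
rewrite -lam_sqr.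
have -> : (gamma * `|x|) ^+ 2 - 2 * lam * (gamma * `|x|) + lam ^+ 2 =
  (gamma * `|x| - lam) ^+ 2 by ring.
exact: sqr_ge0.
Qed.

(** The unit jumps of x contribute beta p + beta z <= 3 beta p. In 46, the cubic term accounts for
    43 and the rest covers the errors of [quad_lower]. *)
Lemma lyapunov_drift :
  beta * p * ((x - 1) ^+ 2 + (gamma * p)^-1 * U1 ^+ 3 -
    (x ^+ 2 + (gamma * p)^-1 * U ^+ 3)) +
  beta * z * ((x + 1) ^+ 2 + (gamma * p)^-1 * U2 ^+ 3 -
    (x ^+ 2 + (gamma * p)^-1 * U ^+ 3)) <=
  (46 * beta + 3) * (beta * p) - beta * lam * `|x|.
Proof.
move: gamma_ge1 f_gt0 p_gt0 lam_ge0 gamma_f lam_f lam_gamma z_ge z_lt xz_le =>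
  g1 f0 p0 l0 gf lf lg zge zlt xzle.
move: gamma_cube rate_ge1 => gc r1.
have g0 : 0 < gamma by lra.
have c0 y : 0 <= clamp y by rewrite /clamp le_max lexx orbT.
have z0 : 0 <= z by rewrite (le_trans (c0 x)).
have gp0 : 0 < gamma * p by rewrite mulr_gt0.
have b0 := ltW beta_gt0.
have f1 : f + 1 <= gamma * (f + 1) by rewrite ler_peMl//; lra.
have zp : z <= 2 * p by lra.
have bz2 : beta * z <= 2 * (beta * p) by rewrite mulrCA ler_wpM2l.
set D := beta * p * (U1 ^+ 3 - U ^+ 3) + beta * z * (U2 ^+ 3 - U ^+ 3).
have -> : beta * p * ((x - 1) ^+ 2 + (gamma * p)^-1 * U1 ^+ 3 -
      (x ^+ 2 + (gamma * p)^-1 * U ^+ 3)) +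
    beta * z * ((x + 1) ^+ 2 + (gamma * p)^-1 * U2 ^+ 3 -
      (x ^+ 2 + (gamma * p)^-1 * U ^+ 3)) =
    beta * (2 * (x * (z - p))) + beta * p + beta * z + (gamma * p)^-1 * D.
  by rewrite /D; ring.
have bb : beta <= beta * (beta * p) by rewrite ler_peMr.
have lx0 : 0 <= lam * `|x| by rewrite mulr_ge0.
have blx : 0 <= beta * (lam * `|x|) by rewrite mulr_ge0.
suff main : 2 * (x * (z - p)) + beta^-1 * ((gamma * p)^-1 * D) <=
    46 * (beta * p) - lam * `|x|.
  have := ler_wpM2l b0 main; rewrite mulrDr mulVKf ?gt_eqF//; lra.
have [T0|T0] := ltP 0 (clamp x); last first.
  have {}T0 : clamp x = 0 by apply/le_anti; rewrite T0 c0.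
  have D1 : beta^-1 * ((gamma * p)^-1 * D) <= 1.
    rewrite ler_pdivrMl// ler_pdivrMl// mulr1.
    apply: (le_trans (cubic_drift_zero T0)).
    by rewrite [gamma * p * beta]mulrC ler_wpM2l// ler_peMl// ltW.
  have gx : p <= gamma * x.
    case: (clampP x) => [[h e]|[/andP[h h'] e]|[h _]]; lra.
  have x0 : 0 < x by rewrite -(pmulr_rgt0 _ g0) (lt_le_trans p_gt0).
  (* Combined with [xz_le], this gives z - p <= f + 1 - x <= - x / 2. *)
  have x2f : 2 * (f + 1) <= x.
    by rewrite -(ler_pM2l g0); apply: le_trans gx; lra.
  have xlam : lam <= x by rewrite -(ler_pM2l g0); apply: le_trans gx; rewrite mulrC.
  have xx : 2 * (x * (z - p)) <= - (x * x).
    have : x * (z - p) <= x * (- (x / 2)) by rewrite ler_wpM2l ?(ltW x0)//; lra.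
    have -> : x * (- (x / 2)) = - (x * x) / 2 by ring.
    lra.
  have : lam * x <= x * x by rewrite ler_wpM2r// ltW.
  rewrite gtr0_norm//; lra.
(* The division leaves an error 43 gamma^3, and [gamma_cube] bounds gamma^3 by beta p. *)
have DU : beta^-1 * ((gamma * p)^-1 * D) <= - (gamma^-1 * U ^+ 2) + 43 * (beta * p).
  rewrite ler_pdivrMl// ler_pdivrMl//.
  apply: (le_trans (cubic_drift T0)).
  have -> : gamma * p * (beta * (- (gamma^-1 * U ^+ 2) + 43 * (beta * p))) =
    - (beta * p) * U ^+ 2 + 43 * (beta * p) * gamma * (beta * p).
    by field; rewrite gt_eqF.
  rewrite lerD2l.
  have g4 : gamma ^+ 4 <= gamma * (beta * p) by rewrite exprS ler_wpM2l// ltW.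
  have : 0 <= 43 * (beta * p) by rewrite mulr_ge0// (le_trans ler01).
  by move=> /ler_wpM2l le43; rewrite -[X in _ <= X]mulrA; exact: le43.
have U2g : 0 <= gamma^-1 * U ^+ 2 by rewrite mulr_ge0 ?sqr_ge0 ?invr_ge0 ?(ltW g0).
have [x0|x0] := lerP x 0.
  have : x * (z - p) <= beta * p - lam * `|x|.
    (* For x <= 0 the cross term x U is nonpositive and is dropped. *)
    have xT : x * (z - p) <= x * (clamp x - p) by rewrite ler_wnM2l//; lra.
    apply: (le_trans xT); case: (clampP x) => [[h ->]|[_ ->]|[_ e]]; last by lra.
      have : x * f <= x * lam by rewrite ler_wnM2l.
      have -> : p + f - p = f by ring.
      have := mulr_ge0 b0 (ltW p_gt0).
      rewrite ler0_norm//; lra.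
    have -> : x * (p - gamma * x - p) = - (gamma * x ^+ 2) by ring.
    by have := quad_lower; lra.
  have := mulr_ge0 b0 (ltW p_gt0); lra.
have Tlin : clamp x = p - gamma * x.
  have := mulr_gt0 g0 x0.
  case: (clampP x) => [[h e]|[_ ->]|[_ e]] //; lra.
have zU : z - p = U - gamma * x by rewrite /U Tlin; ring.
have young : 2 * (x * (U - gamma * x)) <= gamma^-1 * U ^+ 2 - gamma * x ^+ 2.
  rewrite -subr_ge0.
  have -> : gamma^-1 * U ^+ 2 - gamma * x ^+ 2 - 2 * (x * (U - gamma * x)) =
    gamma^-1 * (U - gamma * x) ^+ 2 by field; rewrite gt_eqF.
  by rewrite mulr_ge0 ?sqr_ge0 ?invr_ge0 ?(ltW g0).
rewrite zU; have := quad_lower; have := mulr_ge0 b0 (ltW p_gt0); lra.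
Qed.

End drift_inequality.

(** * The inventory chain *)

Lemma absz_ceil_itv {R : realType} (a : R) : 0 <= a ->
  a <= (`|Num.ceil a|%N)%:R < a + 1.
Proof.
move=> a0; rewrite natr_absz ger0_norm; last by rewrite ceil_ge0 (lt_le_trans _ a0)// ltrN10.
rewrite ceil_ge/= -ltrBlDr; apply: le_lt_trans (ceilB1_lt a).
by rewrite intrD.
Qed.

Lemma leq_of_ltrD1 {R : realType} (m n : nat) : (m%:R : R) < n%:R + 1 -> (m <= n)%N.
Proof. by rewrite natr1 ltr_nat ltnS. Qed.

Section gbs_chain.
Context {R : realType}.
Variables (beta r gamma f xs : R).
Hypothesis beta_gt0 : 0 < beta.
Hypothesis r_gt0 : 0 < r.
Hypothesis gamma_ge1 : 1 <= gamma.
Hypothesis f_gt0 : 0 < f.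

Let p := pipeline_mean beta r.
Let top := `|Num.ceil (p + f)|%N.
Let level := gbs_order_level beta r gamma f xs.
Let target := gbs_trunc_target beta r gamma f xs.
Let trans := gbs_trans beta r gamma f xs.
Let E := gbs_state_space beta r gamma f xs.
Let dev (y : int) : R := y%:~R - xs.

Let p_gt0 : 0 < p. Proof. by rewrite /p divr_gt0. Qed.

Lemma top_itv : p + f <= top%:R < p + f + 1.
Proof. by apply: absz_ceil_itv; rewrite addr_ge0// ltW. Qed.

Lemma target_itv y : 0 <= target y <= p + f.
Proof.
rewrite /target /gbs_trunc_target le_max lexx orbT ge_max ge_min lexx orbT/=.
by rewrite addr_ge0// ltW.
Qed.

Lemma level_itv y : target y <= (level y)%:R < target y + 1.
Proof. by apply: absz_ceil_itv; case/andP: (target_itv y). Qed.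

Lemma level_le_top y : (level y <= top)%N.
Proof.
apply: (@leq_of_ltrD1 R).
have /andP[_ h] := level_itv y; have /andP[_ h'] := target_itv y.
have /andP[h'' _] := top_itv; lra.
Qed.

Lemma level_low y : f <= - gamma * dev y -> level y = top.
Proof.
move=> fy; rewrite /level /gbs_order_level /gbs_trunc_target /gbs_target.
have pf : 0 <= p + f by rewrite addr_ge0// ltW.
rewrite min_r ?max_l//.
by move: fy; rewrite /dev/= -/p; lra.
Qed.

(** Invariants of the chain. The last one bounds the inventory position, which a demand lowers, an
    item arrival preserves and only an order raises. *)
Definition admissible (s : inv_state) : Prop :=
  [/\ target s.1 <= s.2%:R, (s.2 <= top)%N & dev s.1 + s.2%:R <= p + f + 1].

(** For [dev y <= 0] the cap p + f suffices; otherwise gamma >= 1 gives target <= p - gamma dev <= p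
    - dev. Rounding adds at most 1. *)
Lemma order_up_bound y : 0 < target y -> dev y + (level y)%:R <= p + f + 1.
Proof.
move=> T0; have /andP[_ lT] := level_itv y.
move: T0 lT; rewrite /target /gbs_trunc_target /gbs_target -/p -/(dev y).
have g1 := gamma_ge1; have f0 := f_gt0; have p0 := p_gt0.
have [d0|d0] := leP (dev y) 0.
  have /andP[_] := target_itv y.
  by rewrite /target /gbs_trunc_target /gbs_target -/p -/(dev y); lra.
have gd : dev y <= gamma * dev y by rewrite ler_peMl// ltW.
rewrite min_l; last lra.
rewrite lt_max ltxx orbF => h.
by rewrite max_l ?(ltW h)//; lra.
Qed.

Lemma admissible_order y z : (z <= top)%N -> dev y + z%:R <= p + f + 1 ->
  admissible (y, maxn z (level y)).
Proof.
move=> zt yz; have /andP[Tl lT] := level_itv y; split=> /=.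
- by rewrite (le_trans Tl)// ler_nat leq_maxr.
- by rewrite geq_max zt level_le_top.
- have [lz|zl] := leqP (level y) z => //.
  (* An order means [level y > z >= 0], so the target is positive. *)
  apply: order_up_bound.
  have /andP[T0 _] := target_itv y; rewrite lt_def T0 andbT.
  apply/eqP => T00; move: zl; rewrite /level /gbs_order_level.
  by rewrite [gbs_trunc_target _ _ _ _ _ _]T00 ceil0.
Qed.

Lemma step_gbsP s s' : step trans s s' ->
  s' = (s.1 - 1, maxn s.2 (level (s.1 - 1))) \/
  ((0 < s.2)%N /\ s' = (s.1 + 1, maxn s.2.-1 (level (s.1 + 1)))).
Proof.
case: s => y z; rewrite /step/= orbF => /orP[/andP[_ /eqP <-]|]; first by left.
case/andP => bz /eqP <-; right; split=> //.
by move: bz; rewrite pmulr_rgt0// ltr0n.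
Qed.

Lemma admissible_step s s' : admissible s -> step trans s s' -> admissible s'.
Proof.
case: s => y z [/= Tz zt yz] /step_gbsP[|[z0]] -> /=; apply: admissible_order => //.
- by move: yz; rewrite /dev intrB; lra.
- by rewrite (leq_trans (leq_pred z)).
- move: z0 yz => /= /prednK <-; rewrite /dev intrD -natr1/=; lra.
Qed.

Lemma admissible_reachable s s' : admissible s -> reachable trans s s' -> admissible s'.
Proof.
move=> + [q [+ <-]]; elim: q s => //= t q IH s As /andP[st tq].
exact: IH (admissible_step _ _ As st) tq.
Qed.

Lemma reachable_trans s1 s2 s3 : reachable trans s1 s2 -> reachable trans s2 s3 ->
  reachable trans s1 s3.
Proof.
move=> [q [h1 h2]] [q' [h3 h4]]; exists (q ++ q').
by rewrite cat_path h1 h2 last_cat h2.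
Qed.

Lemma reachable_step s s' : step trans s s' -> reachable trans s s'.
Proof. by move=> ss; exists [:: s']; rewrite /= ss. Qed.

(** At or below [low] the target is at its cap, so a jump landing there refills the pipeline to
    [top]. *)
Let low : int := Num.floor (xs - f).

Lemma low_le y : y <= low -> f <= - gamma * dev y.
Proof.
move=> yl; have : (y%:~R : R) <= xs - f.
  by rewrite (le_trans _ (floor_le _))// ler_int.
have g1 := gamma_ge1; have f0 := f_gt0.
rewrite /dev => h.
have : f * 1 <= gamma * - (y%:~R - xs).
  by rewrite mulrC; apply: ler_pM => //; lra.
by lra.
Qed.

Lemma admissible_low y : y <= low -> admissible (y, top).
Proof.
move=> yl; have lt := level_low y (low_le y yl).
rewrite (_ : (y, top) = (y, maxn top (level y))); last by rewrite lt maxnn.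
apply: admissible_order => //.
have /andP[_ h] := top_itv.
have : (y%:~R : R) <= xs - f by rewrite (le_trans _ (floor_le _))// ler_int.
by have f0 := f_gt0; rewrite /dev; lra.
Qed.

Lemma admissible_space s : E s -> admissible s.
Proof.
move=> [y0 /(_ (Num.min y0 low))]; rewrite ge_min lexx => /(_ isT).
by apply: admissible_reachable; apply: admissible_low; rewrite ge_min lexx orbT.
Qed.

Lemma space_closed s s' : E s -> step trans s s' -> E s'.
Proof.
move=> [y0 Es] ss; exists y0 => y yy0.
exact: reachable_trans (Es y yy0) (reachable_step _ _ ss).
Qed.

Lemma top_gt0 : (0 < top)%N.
Proof.
rewrite -(@ltr_nat R); have /andP[h _] := top_itv.
by apply: lt_le_trans h; rewrite addr_gt0.
Qed.

Lemma reachable_up y n : y + n%:Z <= low -> reachable trans (y, top) (y + n%:Z, top).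
Proof.
elim: n y => [|n IH] y yl; first by exists [::]; rewrite addr0.
have y1l : (y + 1) + n%:Z <= low by move: yl; lia.
apply: reachable_trans (_ : reachable trans _ (y + 1, top)) _; last first.
  by rewrite (_ : y + n.+1%:Z = y + 1 + n%:Z); [exact: IH|lia].
apply: reachable_step; apply/hasP.
exists (beta * top%:R, (y + 1, maxn top.-1 (level (y + 1)))).
  by rewrite /trans/gbs_trans/= !inE eqxx orbT.
have -> : level (y + 1) = top by apply/level_low/low_le; move: y1l; lia.
rewrite /= pmulr_rgt0// ltr0n top_gt0/=.
by rewrite (maxn_idPr (leq_pred _)).
Qed.

Lemma reachable_down y z n : (z <= top)%N -> y - n%:Z <= low -> (0 < n)%N ->
  reachable trans (y, z) (y - n%:Z, top).
Proof.
elim: n y z => // n IH y z zt yl _.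
have st : step trans (y, z) (y - 1, maxn z (level (y - 1))).
  by apply/hasP; exists (r, (y - 1, maxn z (level (y - 1)))); rewrite ?inE ?eqxx//= andbT.
have [n0|n0] := posnP n.
  rewrite n0 in yl *; have e : maxn z (level (y - 1)) = top.
    by rewrite level_low ?(maxn_idPr zt)//; apply: low_le.
  by rewrite e in st; exact: reachable_step.
apply: reachable_trans (reachable_step _ _ st) _.
rewrite (_ : y - n.+1%:Z = y - 1 - n%:Z); last lia.
apply: IH => //; last by move: yl; lia.
by rewrite geq_max zt level_le_top.
Qed.

(** Demands alone lead from [s] to some (y', top) with y' as low as needed, and such states reach
    [s'] by the definition of the state space. *)
Lemma space_irreducible s s' : E s -> E s' -> reachable trans s s'.
Proof.
move=> /admissible_space; case: s => y z [/= _ zt _] [y0 Es'].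
pose m := Num.min y0 low.
(* The successor forces at least one demand, so that the last one resets the in-transit count to
   [top]. *)
pose n := (`|y - m|%N).+1.
have yn : y - n%:Z <= m by rewrite /n; lia.
have [ml my] : m <= low /\ m <= y0 by rewrite !ge_min !lexx orbT.
apply: reachable_trans (reachable_down y z n zt (le_trans yn ml) isT) (Es' _ (le_trans yn my)).
Qed.

Lemma space_low : E (low, top).
Proof.
exists low => y yl; rewrite [X in (X, top)](_ : low = y + `|low - y|%N%:Z); last lia.
by apply: reachable_up; lia.
Qed.

Lemma exit_rate_gbs s : exit_rate trans s = r + beta * s.2%:R.
Proof. by case: s => y z; rewrite /exit_rate /trans /gbs_trans !big_cons big_nil addr0. Qed.

Lemma trans_gbs_ge0 s a : a \in trans s -> 0 <= a.1.
Proof.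
by case: s => y z; rewrite !inE => /orP[]/eqP -> /=; rewrite ?mulr_ge0// ltW.
Qed.

Lemma finite_bounded_dev (M : R) : finite_set [set s | E s /\ `|dev s.1| <= M].
Proof.
pose m := (`|Num.ceil (`|xs| + M)|%N).
pose L := [seq (Posz u.1 - Posz m, u.2) : inv_state |
  u <- [seq (a, b) | a <- iota 0 (m + m).+1, b <- iota 0 top.+1]].
apply: (@sub_finite_set _ _ [set` L]); last exact: finite_seq.
move=> [y z] [/admissible_space[/= _ zt _] yM].
have ym : (`|y| <= m)%N.
  rewrite -(@ler_nat R) natr_absz.
  have M0 : 0 <= `|xs| + M by rewrite addr_ge0// (le_trans _ yM).
  have /andP[h _] := absz_ceil_itv _ M0; apply: le_trans h.
  rewrite intr_norm -[y%:~R](subrK xs) addrC (le_trans (ler_normD _ _))//.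
  by rewrite lerD2l.
suff : (y, z) \in L by [].
apply/mapP; exists (absz (y + m%:Z), z); last by congr pair; rewrite /=; lia.
apply/allpairsP; exists (absz (y + m%:Z), z); split; rewrite ?mem_iota//=; lia.
Qed.

End gbs_chain.

(** * Stability and first moment of the inventory chain *)

Section gbs_stability.
Context {R : realType}.
Variables (beta r gamma f xs : R).
Hypothesis beta_gt0 : 0 < beta.
Hypothesis r_ge1 : 1 <= r.
Hypothesis gamma_ge1 : 1 <= gamma.
Hypothesis f_gt0 : 0 < f.
Hypothesis gamma_f : 2 * beta * gamma * (f + 1) <= r.
Hypothesis gamma_r : gamma * r <= f ^+ 2.
Hypothesis gamma_beta : beta ^+ 2 * gamma ^+ 3 <= r.
Hypothesis gamma_cube : gamma ^+ 3 <= r.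

Let r_gt0 : 0 < r. Proof. exact: lt_le_trans r_ge1. Qed.
Let gamma_gt0 : 0 < gamma. Proof. exact: lt_le_trans gamma_ge1. Qed.
Let p := pipeline_mean beta r.
Let target := gbs_trunc_target beta r gamma f xs.
Let level := gbs_order_level beta r gamma f xs.
Let top := `|Num.ceil (p + f)|%N.
Let trans := gbs_trans beta r gamma f xs.
Let E := gbs_state_space beta r gamma f xs.
Let dev (y : int) : R := y%:~R - xs.
Let lam := Num.sqrt (gamma * r).

Let bp : beta * p = r.
Proof. by rewrite /p /pipeline_mean mulrC divfK// gt_eqF. Qed.

Let p_gt0 : 0 < p. Proof. by rewrite /p /pipeline_mean divr_gt0. Qed.

Let lam_sqr : lam ^+ 2 = gamma * (beta * p).
Proof. by rewrite bp sqr_sqrtr// mulr_ge0// ltW. Qed.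

Let lam_f : lam <= f.
Proof. by rewrite -(@ler_sqr R) ?nnegrE ?sqrtr_ge0 ?(ltW f_gt0)// lam_sqr bp. Qed.

Let lam_gamma : lam * gamma <= p.
Proof.
have lg0 : 0 <= lam * gamma by rewrite mulr_ge0 ?sqrtr_ge0 ?(ltW gamma_gt0).
rewrite -(@ler_sqr R) ?nnegrE ?(ltW p_gt0)//.
have b2 : 0 < beta ^+ 2 by rewrite exprn_gt0.
rewrite -(ler_pM2l b2) exprMn lam_sqr bp -[leRHS]exprMn bp.
have -> : beta ^+ 2 * (gamma * r * gamma ^+ 2) = beta ^+ 2 * gamma ^+ 3 * r by ring.
by rewrite expr2 ler_wpM2r// ltW.
Qed.

Definition lyapunov (s : inv_state) : R :=
  dev s.1 ^+ 2 + (gamma * p)^-1 * (s.2%:R - target s.1) ^+ 3.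

(** Without an order the excess is [z] minus the target; after an order it is the rounding error of
    the ceiling, below 1. *)
Lemma order_excess_le (z : nat) y (t : R) : t = z%:R ->
  0 <= (maxn z (level y))%:R - target y <= Num.max (t - target y) 1.
Proof.
move=> ->; have /andP[h1 h2] := level_itv beta r gamma f xs beta_gt0 r_gt0 f_gt0 y.
rewrite -/level -/target in h1 h2; apply/andP; split.
  by rewrite subr_ge0 (le_trans h1)// ler_nat leq_maxr.
rewrite le_max; have [_|_] := leqP (level y) z; first by rewrite lexx.
by apply/orP; right; lra.
Qed.

Lemma lyapunov_generator s : E s ->
  generator trans lyapunov s <= (46 * beta + 3) * r - beta * lam * `|dev s.1|.
Proof.
move=> /(admissible_space _ _ _ _ _ beta_gt0 r_gt0 gamma_ge1 f_gt0).
case: s => y z [/= Tz zt yz]; rewrite /generator /trans /gbs_trans !big_cons big_nil addr0/=.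
rewrite /lyapunov/= /dev intrB intrD -/level.
have -> : y%:~R - 1 - xs = dev y - 1 by rewrite /dev; ring.
have -> : y%:~R + 1 - xs = dev y + 1 by rewrite /dev; ring.
have subE : target (y - 1) = clamp gamma f p (dev y - 1).
  by rewrite /target /gbs_trunc_target /gbs_target /clamp /dev intrB;
    congr (Num.max (Num.min (_ - gamma * _) _) _); ring.
have addE : target (y + 1) = clamp gamma f p (dev y + 1).
  by rewrite /target /gbs_trunc_target /gbs_target /clamp /dev intrD;
    congr (Num.max (Num.min (_ - gamma * _) _) _); ring.
have /andP[U10 U1] := order_excess_le z (y - 1) z%:R erefl.
have /andP[U20 U2] := order_excess_le z.-1 (y + 1) z.-1%:R erefl.
have zltop : z%:R < p + f + 1.
  have /andP[_] := top_itv beta r f beta_gt0 r_gt0 f_gt0.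
  by apply: le_lt_trans; rewrite ler_nat.
(* At z = 0, [z.-1] is 0 and not -1, but the excess is at most 1 there. *)
have U2' : (maxn z.-1 (level (y + 1)))%:R - target (y + 1) <=
    Num.max (z%:R - 1 - target (y + 1)) 1.
  case: (posnP z) U2 => [z0|z0]; last first.
    by rewrite -[in z%:R](prednK z0) -natr1 addrK.
  rewrite z0/= => /le_trans; apply; rewrite ge_max !le_max lexx !orbT andbT.
  apply/orP; right; have /andP[] := target_itv beta r gamma f xs beta_gt0 r_gt0 f_gt0 (y + 1).
  by rewrite -/target; lra.
have := lyapunov_drift beta gamma f p lam beta_gt0 gamma_ge1 f_gt0 p_gt0 (sqrtr_ge0 _)
  _ lam_f lam_sqr lam_gamma _ _ (dev y) z%:R _ _ Tz zltop yz _ U10 _ U20 _.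
rewrite bp; apply => //.
- rewrite -(ler_pM2l beta_gt0) bp; apply: le_trans gamma_f.
  by rewrite le_eqVlt; apply/orP; left; apply/eqP; ring.
- by case: z {Tz zt yz U1 U2 U10 U20 zltop U2'} => [|z]; [left|right; rewrite ler1n].
- by rewrite -subE.
- by rewrite -addE.
Qed.

Lemma lyapunov_ge_sqr s : E s -> dev s.1 ^+ 2 <= lyapunov s.
Proof.
move=> /(admissible_space _ _ _ _ _ beta_gt0 r_gt0 gamma_ge1 f_gt0)[Tz _ _].
rewrite /lyapunov lerDl; apply: mulr_ge0; first by rewrite invr_ge0 mulr_ge0// ltW.
by rewrite exprn_ge0// subr_ge0.
Qed.

Let drift_bound := (46 * beta + 3) * r.
Let phi (s : inv_state) : R := beta * lam * `|dev s.1|.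

Let blam_gt0 : 0 < beta * lam.
Proof. by rewrite mulr_gt0// sqrtr_gt0 mulr_gt0. Qed.

Let drift_bound_ge0 : 0 <= drift_bound.
Proof.
by rewrite /drift_bound mulr_ge0 ?(ltW r_gt0)// addr_ge0// mulr_ge0// ltW.
Qed.

Let exit_lo s : E s -> r <= exit_rate trans s.
Proof. by move=> _; rewrite exit_rate_gbs lerDl mulr_ge0// ltW. Qed.

Let exit_hi s : E s -> exit_rate trans s <= r + beta * top%:R.
Proof.
move=> /(admissible_space _ _ _ _ _ beta_gt0 r_gt0 gamma_ge1 f_gt0)[_ zt _].
by rewrite exit_rate_gbs lerD2l ler_wpM2l ?(ltW beta_gt0)// ler_nat.
Qed.

Let trans_ge0 s a : a \in trans s -> 0 <= a.1.
Proof. exact: trans_gbs_ge0. Qed.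

Let closedE s s' : E s -> step trans s s' -> E s'.
Proof. exact: space_closed. Qed.

Let superharmonic i : E i -> exists W : inv_state -> R,
  (forall s, E s -> 0 <= W s) /\
  forall s, E s -> (exit_rate trans s)^-1 + killed trans i W s <= W s.
Proof.
move=> Ei.
apply: (superharmonic_of_drift trans E r trans_ge0 closedE r_gt0 exit_lo i
  lyapunov phi drift_bound) => //.
- by move=> s s'; exact: space_irreducible.
- by move=> s Es; rewrite (le_trans (sqr_ge0 _) (lyapunov_ge_sqr s Es)).
- by move=> s _; rewrite /phi mulr_ge0// ltW.
- by move=> s; exact: lyapunov_generator.
apply: sub_finite_set (finite_bounded_dev beta r gamma f xs beta_gt0 r_gt0 gamma_ge1
  f_gt0 ((drift_bound + 1) / (beta * lam))).
by move=> s [Es /ltW sb]; split => //; rewrite ler_pdivlMr// mulrC.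
Qed.

Lemma gbs_positive_recurrent : positive_recurrent trans E.
Proof.
move=> i Ei; have [W [W0 dW]] := superharmonic i Ei.
exact: (positive_recurrent_of_superharmonic trans E r (r + beta * top%:R)
  trans_ge0 closedE r_gt0 exit_lo exit_hi i W).
Qed.

Lemma gbs_stationary_exists : exists P : probability inv_state R, stationary trans E P.
Proof.
have El := space_low beta r gamma f xs beta_gt0 r_gt0 gamma_ge1 f_gt0.
have [W [W0 dW]] := superharmonic _ El.
by apply: (stationary_exists trans E r (r + beta * top%:R) _ trans_ge0 closedE
  r_gt0 exit_lo exit_hi _ El W).
Qed.

(** [moment_bound] bounds the mean of beta lam |dev| by [drift_bound]; since lam sqrt r = r sqrt
    gamma, the factor r cancels. *)
Lemma gbs_moment (P : probability inv_state R) : stationary trans E P ->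
  (\int[P]_s (`|dev s.1| / Num.sqrt r)%:E <=
   ((46 * beta + 3) / (beta * Num.sqrt gamma))%:E)%E.
Proof.
move=> Pst.
have L0 : 0 <= r + beta * top%:R by rewrite addr_ge0 ?mulr_ge0// ltW.
have sr0 : 0 < Num.sqrt r by rewrite sqrtr_gt0.
have sg0 : 0 < Num.sqrt gamma by rewrite sqrtr_gt0.
have c0 : 0 < (beta * lam * Num.sqrt r)^-1 by rewrite invr_gt0 mulr_gt0.
have -> : (46 * beta + 3) / (beta * Num.sqrt gamma) =
    (beta * lam * Num.sqrt r)^-1 * drift_bound.
  rewrite /drift_bound /lam sqrtrM ?(ltW gamma_gt0)//.
  rewrite -[X in _ * (_ * X)](sqr_sqrtr (ltW r_gt0)).
  by field; rewrite !gt_eqF.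
have -> : (\int[P]_s (`|dev s.1| / Num.sqrt r)%:E =
    (beta * lam * Num.sqrt r)^-1%:E * \int[P]_s (phi s)%:E)%E.
  rewrite -ge0_integralZl_EFin//; last 2 first.
  - by move=> s _; rewrite lee_fin /phi mulr_ge0// ltW.
  - exact: ltW.
  apply: eq_integral => s _; rewrite -EFinM; congr (_%:E).
  by rewrite /phi; field; rewrite !gt_eqF// sqrtr_gt0 mulr_gt0.
rewrite EFinM lee_pmul2l// ?lte_fin//.
apply: (moment_bound trans E (r + beta * top%:R) _ trans_ge0 closedE exit_hi L0 P Pst
  lyapunov) => //.
- by move=> s Es; rewrite (le_trans (sqr_ge0 _) (lyapunov_ge_sqr s Es)).
- by move=> s _; rewrite /phi mulr_ge0// ltW.
- by move=> s; exact: lyapunov_generator.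
move=> M; apply: sub_finite_set (finite_bounded_dev beta r gamma f xs beta_gt0 r_gt0
  gamma_ge1 f_gt0 (M%:R + 1)).
move=> s [Es VM]; split => //.
have := le_lt_trans (lyapunov_ge_sqr s Es) VM; rewrite -/(dev s.1) -real_normK ?num_real//.
have [d1|d1] := leP `|dev s.1| 1 => dM; first by rewrite (le_trans d1)// lerDr.
have : `|dev s.1| * 1 <= `|dev s.1| ^+ 2 by rewrite expr2 ler_wpM2l// ltW.
lra.
Qed.

End gbs_stability.

(** * Limits *)

(** Continuity at 0 for small x and boundedness of g for large x give |g x - g 0| <= e / 2 + c |x|,
    which is then integrated. *)
Lemma cvg_in_distribution_of_L1 {d : measure_display} {R : realType}
    {T : measurableType d} (P : nat -> probability T R) (X : nat -> T -> R) :
  (forall A : set T, measurable A) ->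
  (\int[P n]_w (`|X n w|)%:E)%E @[n --> \oo] --> 0%E ->
  cvg_in_distribution P X \d_(0 : measurableTypeR R).
Proof.
move=> measT X0 g gc [M gM].
have M0 : 0 <= M by rewrite (le_trans _ (gM 0)).
have mg : measurable_fun [set: measurableTypeR R] g.
  exact: measurable_realfun.continuous_measurable_fun.
rewrite [X in _ --> X]integral_dirac//; last exact/measurable_realfun.measurable_EFinP.
rewrite diracT mul1e.
have PT n : P n setT = 1%E by exact: probability_setT.
have ig n : (P n).-integrable setT (EFin \o (fun w => g (X n w))).
  apply: (bounded_integrable _ measT _ (PT n) _ M) => w _; exact: gM.
have ic n (c : R) : (P n).-integrable setT (EFin \o (fun=> c)).
  by apply: (bounded_integrable _ measT _ (PT n) _ `|c|).
have gE n : (\int[P n]_w (g (X n w))%:E = (\int[P n]_w g (X n w))%:E)%E.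
  by rewrite /Rintegral fineK//; exact: (integrable_fin_num measurableT (ig n)).
under eq_fun do rewrite gE.
apply: cvg_EFin; first exact: nearW.
apply/cvgrPdist_le => e e0.
have e2 : 0 < e / 2 by rewrite divr_gt0.
have /cvgrPdist_le/(_ _ e2)/nbhs_ballP[dl /= dl0 gdl] := gc 0.
pose c := 2 * M / dl.
have c0 : 0 <= c by rewrite divr_ge0 ?mulr_ge0// ltW.
have gX x : `|g x - g 0| <= e / 2 + c * `|x|.
  have [xd|xd] := ltP `|x| dl.
    rewrite distrC (le_trans (gdl x _))//; first by rewrite /ball/= sub0r normrN.
    by rewrite lerDl mulr_ge0.
  rewrite (le_trans (ler_normB _ _))// (le_trans (lerD (gM x) (gM 0)))//.
  have : c * dl <= c * `|x| by rewrite ler_wpM2l.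
  by rewrite /c divfK ?gt_eqF//; lra.
(* The divisor is c + 1 because c may be 0. *)
have near_small : \forall n \near \oo, (\int[P n]_w (`|X n w|)%:E <= (e / 2 / (c + 1))%:E)%E.
  have /fine_cvgP[Xfin Xcvg] := X0.
  have s0 : 0 < e / 2 / (c + 1) by rewrite divr_gt0// ltr_wpDl.
  near=> n; rewrite -[leLHS]fineK; last by near: n.
  by rewrite lee_fin; near: n; apply: (cvgr_le _ Xcvg).
near=> n.
have Xs : (\int[P n]_w (`|X n w|)%:E <= (e / 2 / (c + 1))%:E)%E by near: n.
have -> : g 0 - \int[P n]_w g (X n w) = \int[P n]_w (g 0 - g (X n w)).
  rewrite (RintegralB measurableT (ic n (g 0)) (ig n)).
  by rewrite (Rintegral_carrier_cst _ measT _ (PT n)).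
have ib : (P n).-integrable setT (EFin \o (fun w => g 0 - g (X n w))).
  exact: (integrableB measurableT (ic n (g 0)) (ig n)).
rewrite -lee_fin EFin_normr_Rintegral//.
apply: le_trans (le_abse_integral _ _ _) _ => //.
apply: (@le_trans _ _ (\int[P n]_w ((e / 2)%:E + (c * `|X n w|)%:E))%E).
  apply: ge0_le_integral => //.
  - by move=> w _; rewrite -EFinD lee_fin distrC gX.
rewrite ge0_integralD//; do ?by move=> w _; rewrite lee_fin (ltW e2, mulr_ge0).
rewrite integral_cst// [X in (_ * X)%E]PT mule1.
under eq_integral do rewrite EFinM.
rewrite ge0_integralZl_EFin//.
apply: (@le_trans _ _ ((e / 2)%:E + c%:E * (e / 2 / (c + 1))%:E)%E).
  by apply: leeD => //; apply: lee_wpmul2l.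
rewrite -EFinM -EFinD lee_fin mulrA.
have : c * (e / 2) / (c + 1) <= e / 2.
  by rewrite ler_pdivrMr ?ltr_wpDl// mulrC ler_wpM2l ?(ltW e2)// lerDl.
lra.
Unshelve. all: by end_near.
Qed.

(** An upper bound for gamma at demand rate x. The first term ensures 2 gamma (f + 1) <= p, the
    second sqrt(gamma r) <= f; the fourth root makes gamma^3, even times beta^2, at most r for large
    r. *)
Definition gain {R : realType} (beta f x : R) : R :=
  Num.min (Num.min (x / (2 * beta * (f + 1))) (f ^+ 2 / x)) (Num.sqrt (Num.sqrt x)).

Lemma gain_pinfty {R : realType} (beta : R) (r : nat -> R) (f : R -> R) (k : R) :
  0 < beta -> (forall n, 0 < r n) -> r n @[n --> \oo] --> +oo ->
  (forall n, 0 < f (r n)) ->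
  f (r n) / r n @[n --> \oo] --> (0 : R) ->
  f (r n) / Num.sqrt (r n) @[n --> \oo] --> +oo ->
  \forall n \near \oo, k <= gain beta (f (r n)) (r n).
Proof.
move=> b0 r0 roo f0 fs fl.
pose K := Num.max k 1.
have K1 : 1 <= K by rewrite le_max lexx orbT.
have K0 : 0 < K by exact: lt_le_trans K1.
have kK : k <= K by rewrite le_max lexx.
(* The factor 4 instead of 2 shares [r n] equally between 2 beta K f and 2 beta K. *)
have e0 : 0 < (4 * beta * K)^-1 by rewrite invr_gt0 !mulr_gt0.
near=> n.
have rn := r0 n; have fn := f0 n.
apply: (le_trans kK); rewrite /gain !le_min -andbA; apply/and3P; split.
- have rb : 4 * beta * K <= r n by near: n; apply: cvgry_ge.
  have fr : f (r n) / r n <= (4 * beta * K)^-1.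
    near: n; apply: cvgr_le fs _ _; exact: e0.
  rewrite ler_pdivlMr ?mulr_gt0 ?addr_gt0//.
  move: fr; rewrite ler_pdivrMr// mulrC ler_pdivlMr ?mulr_gt0//; lra.
- have fK : K <= f (r n) / Num.sqrt (r n) by near: n; apply: cvgry_ge.
  have -> : f (r n) ^+ 2 / r n = (f (r n) / Num.sqrt (r n)) ^+ 2.
    by rewrite expr_div_n sqr_sqrtr// ltW.
  by apply: (le_trans fK); rewrite expr2 ler_peMr ?(le_trans K1 fK)// (le_trans _ fK)// ltW.
- have rK : K ^+ 4 <= r n by near: n; apply: cvgry_ge.
  have -> : K = Num.sqrt (Num.sqrt (K ^+ 4)).
    have -> : K ^+ 4 = (K ^+ 2) ^+ 2 by rewrite -exprM.
    by rewrite sqrtr_sqr ger0_norm ?sqr_ge0// sqrtr_sqr gtr0_norm.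
  by rewrite !ler_wsqrtr.
Unshelve. all: by end_near.
Qed.

(** beta^8 <= x means beta^2 <= x^(1/4), while gamma^3 <= x^(3/4). *)
Lemma gain_conditions {R : realType} (beta f x gamma : R) : 0 < beta -> 0 < f ->
  Num.max 1 (beta ^+ 8) <= x -> 1 <= gamma -> gamma <= gain beta f x ->
  [/\ 1 <= x, 2 * beta * gamma * (f + 1) <= x, gamma * x <= f ^+ 2,
      beta ^+ 2 * gamma ^+ 3 <= x & gamma ^+ 3 <= x].
Proof.
move=> b0 f0; rewrite ge_max => /andP[x1 xb] g1.
have x0 : 0 < x by exact: lt_le_trans x1.
rewrite /gain !le_min -andbA => /and3P[h1 h2 h3].
set rho := Num.sqrt (Num.sqrt x) in h3.
have rho4 : x = rho ^+ 4.
  have -> : rho ^+ 4 = (rho ^+ 2) ^+ 2 by rewrite -exprM.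
  by rewrite !sqr_sqrtr ?sqrtr_ge0// ltW.
have g3 : gamma ^+ 3 <= rho ^+ 3 by rewrite lerXn2r ?nnegrE// ?sqrtr_ge0// (le_trans ler01).
have rho0 : 0 <= rho ^+ 3 by rewrite exprn_ge0 ?sqrtr_ge0.
have rho1 : 1 <= rho by exact: le_trans h3.
have rhob : beta ^+ 2 <= rho.
  rewrite -(@ler_pXn2r _ 4) ?nnegrE ?sqr_ge0 ?sqrtr_ge0//.
  by rewrite -rho4 -exprM.
split=> //.
- by move: h1; rewrite ler_pdivlMr ?mulr_gt0 ?addr_gt0//; lra.
- by move: h2; rewrite ler_pdivlMr.
- rewrite rho4 exprS; apply: ler_pM => //; rewrite ?sqr_ge0// exprn_ge0//.
  exact: le_trans g1.
- by rewrite (le_trans g3)// rho4 exprS ler_peMl.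
Qed.

Theorem corollary2 (R : realType) (beta : R) (r : nat -> R) (f xs : R -> R)
  (beta_gt0 : 0 < beta)
  (r_gt0 : forall n, 0 < r n)
  (r_incr : forall m n, (m < n)%N -> r m < r n)
  (r_pinfty : r n @[n --> \oo] --> +oo)
  (f_gt0 : forall n, 0 < f (r n))
  (f_small : f (r n) / r n @[n --> \oo] --> (0 : R))
  (f_large : f (r n) / Num.sqrt (r n) @[n --> \oo] --> +oo) :
  exists gamma : R -> nat,
    let trans n :=
      gbs_trans beta (r n) (gamma (r n))%:R (f (r n)) (xs (r n)) in
    let space n :=
      gbs_state_space beta (r n) (gamma (r n))%:R (f (r n)) (xs (r n)) in
    [/\ forall n, (1 <= gamma (r n))%N,
        \forall n \near \oo,
          positive_recurrent (trans n) (space n) /\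
          exists P : probability inv_state R,
            stationary (trans n) (space n) P
      & forall P : nat -> probability inv_state R,
          (\forall n \near \oo, stationary (trans n) (space n) (P n)) ->
          cvg_in_distribution P
            (fun n s => (s.1%:~R - xs (r n)) / Num.sqrt (r n)) \d_(0 : measurableTypeR R) /\
          (\int[P n]_s (`|s.1%:~R - xs (r n)| / Num.sqrt (r n))%:E)%E
            @[n --> \oo] --> 0%E].
Proof.
(* The maximum with 1 acts only where the gain is below 1, that is, for finitely many [n]. *)
pose gamma x := maxn 1 (Num.trunc (gain beta (f x) x)).
have gamma1 n : (1 <= gamma (r n))%N by rewrite leq_maxl.
have gamma1R n : 1 <= (gamma (r n))%:R :> R by rewrite ler1n.
have gain_large k := gain_pinfty beta r f k beta_gt0 r_gt0 r_pinfty f_gt0 f_small f_large.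
have gammaE n : 1 <= gain beta (f (r n)) (r n) ->
    gamma (r n) = Num.trunc (gain beta (f (r n)) (r n)).
  by move=> g1; rewrite /gamma; apply/maxn_idPr; rewrite truncn_gt0.
have cond : \forall n \near \oo, [/\ 1 <= r n,
    2 * beta * (gamma (r n))%:R * (f (r n) + 1) <= r n,
    (gamma (r n))%:R * r n <= f (r n) ^+ 2,
    beta ^+ 2 * (gamma (r n))%:R ^+ 3 <= r n & (gamma (r n))%:R ^+ 3 <= r n].
  near=> n.
  have g1 : 1 <= gain beta (f (r n)) (r n) by near: n.
  apply: (gain_conditions beta (f (r n)) (r n)) => //.
    by near: n; apply: cvgry_ge.
  by rewrite gammaE// truncn_le (le_trans ler01).
have gamma_large (k : R) : \forall n \near \oo, k <= (gamma (r n))%:R.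
  near=> n.
  have g1 : 1 <= gain beta (f (r n)) (r n) by near: n.
  have gk : k + 1 <= gain beta (f (r n)) (r n) by near: n.
  rewrite gammaE//; have /andP[_] := truncn_itv (le_trans ler01 g1).
  by rewrite -natr1; lra.
exists gamma => trans space; split => //.
  apply: filterS cond => n [h1 h2 h3 h4 h5]; split.
    exact: gbs_positive_recurrent.
  exact: gbs_stationary_exists.
move=> P Pst.
pose C := 46 * beta + 3.
have C0 : 0 < C by rewrite addr_gt0// mulr_gt0.
have L1 : (\int[P n]_s (`|s.1%:~R - xs (r n)| / Num.sqrt (r n))%:E)%E
    @[n --> \oo] --> 0%E.
  apply: (@squeeze_cvge _ _ _ _ (cst 0%E) _
    (fun n => (C / (beta * Num.sqrt (gamma (r n))%:R))%:E)).
  - near=> n.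
    have [h1 h2 h3 h4 h5] : [/\ 1 <= r n,
      2 * beta * (gamma (r n))%:R * (f (r n) + 1) <= r n,
      (gamma (r n))%:R * r n <= f (r n) ^+ 2,
      beta ^+ 2 * (gamma (r n))%:R ^+ 3 <= r n & (gamma (r n))%:R ^+ 3 <= r n].
      by near: n.
    rewrite integral_ge0/=; last by move=> s _; rewrite lee_fin divr_ge0.
    apply: (gbs_moment beta (r n) (gamma (r n))%:R (f (r n)) (xs (r n))) => //.
    by near: n.
  - exact: cvg_cst.
  - apply: cvg_EFin; first exact: nearW.
    apply/cvgrPdist_le => e e0.
    have k0 : 0 < C / (beta * e) by rewrite divr_gt0// mulr_gt0.
    near=> n.
    have gk : (C / (beta * e)) ^+ 2 <= (gamma (r n))%:R by near: n.
    have sg : C / (beta * e) <= Num.sqrt (gamma (r n))%:R.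
      by rewrite -(ger0_norm (ltW k0)) -sqrtr_sqr ler_wsqrtr.
    have sg0 : 0 < Num.sqrt (gamma (r n))%:R :> R by exact: lt_le_trans sg.
    rewrite sub0r normrN gtr0_norm ?divr_gt0 ?mulr_gt0//.
    rewrite ler_pdivrMr ?mulr_gt0//.
    by move: sg; rewrite ler_pdivrMr ?mulr_gt0//; lra.
split=> //; apply: cvg_in_distribution_of_L1 => //.
rewrite (_ : (fun n => _) =
  (fun n => \int[P n]_s (`|s.1%:~R - xs (r n)| / Num.sqrt (r n))%:E)%E)//.
apply/funext => n; apply: eq_integral => s _.
by rewrite normrM normfV (ger0_norm (sqrtr_ge0 _)).
Unshelve. all: by end_near.
Qed.
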